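(* For every integer $k\ge 3$ there exist constants $c(k)$ and $C(k)$ such that: if $p\ge \frac{C(k)}{n}$ then for $T\sim T(n,p)$ w.h.p. $\chi(T)>k$; and if $p\le\frac{c(k)}{n}$ then for $T\sim T(n,p)$ w.h.p. $\chi(T)\le k$. Moreover, $c(k), C(k)=\Theta(k\log k)$.
   Context: For $p\in[0,1]$, the $p$-random tournament $T\sim T(n,p)$ on vertex set $[n]$ is obtained by orienting, independently for every $1\le i<j\le n$, the edge $\{i,j\}$ as $\overrightarrow{ji}$ with probability $p$ and as $\overrightarrow{ij}$ with probability $1-p$. A tournament is $k$-colorable if its vertices can be colored with $k$ colors so that each color class induces a transitive subtournament; $\chi(T)$ is the minimum such $k$. ''W.h.p.'' means with probability tending to $1$ as $n\to\infty$.
   Formalization: The first claim is stated for C(k)/n ≤ p ≤ 1 − C(k)/n instead of all p ≥ C(k)/n, because for p near 1 it is false: T(n,1) is transitive, so χ(T) = 1. *)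

(* Defs.v *)
From HB Require Import structures.
From mathcomp Require Import all_boot all_order all_algebra.
From mathcomp Require Import all_classical all_reals all_analysis.

Set Implicit Arguments.
Unset Strict Implicit.
Unset Printing Implicit Defensive.

Import Order.TTheory GRing.Theory Num.Theory.
Import numFieldNormedType.Exports.

Local Open Scope ring_scope.

(* [(i, j) \in A] stands for the arc i -> j. *)
Definition is_tournament (n : nat) (A : {set 'I_n * 'I_n}) : bool :=
  [forall i, forall j, if i == j then (i, j) \notin A
                       else ((i, j) \in A) (+) ((j, i) \in A)].

Record tournament (n : nat) := Tournament {
  arcs :> {set 'I_n * 'I_n};
  arcsP : is_tournament arcs
}.

HB.instance Definition _ n := [isSub for @arcs n].
HB.instance Definition _ n := [Finite of tournament n by <:].

Definition arc (n : nat) (T : tournament n) : rel 'I_n :=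
  fun i j => (i, j) \in arcs T.

Definition transitive_on (n : nat) (T : tournament n) (S : {set 'I_n}) : bool :=
  [forall x in S, forall y in S, forall z in S,
     arc T x y ==> arc T y z ==> arc T x z].

Definition colorable (n : nat) (T : tournament n) (k : nat) : bool :=
  [exists f : {ffun 'I_n -> 'I_k},
    forall c : 'I_k, transitive_on T [set v | f v == c]].

Lemma colorable_exists (n : nat) (T : tournament n) : exists k, colorable T k.
Proof.
exists n; apply/existsP; exists [ffun v => v]; apply/forallP => c.
do 3![apply/forall_inP => ?; rewrite inE ffunE => /eqP ->].
by apply/implyP => ->; rewrite implybT.
Qed.

Definition chi (n : nat) (T : tournament n) : nat := ex_minn (colorable_exists T).

(* The mass of [T] under T(n,p): for i < j, the backward arc j -> i has
   probability p and the forward arc i -> j has probability 1 - p. *)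
Definition tournament_mass (R : realType) (n : nat) (p : R)
    (T : tournament n) : R :=
  \prod_(e : 'I_n * 'I_n | (e.1 < e.2)%N)
    (if arc T e.2 e.1 then p else 1 - p).

Definition tournament_prob (R : realType) (n : nat) (p : R)
    (E : pred (tournament n)) : R :=
  \sum_(T : tournament n | E T) tournament_mass p T.

Lemma tournament_mass_ge0 (R : realType) (n : nat) (p : R) (T : tournament n) :
  0 <= p <= 1 -> 0 <= tournament_mass p T.
Proof.
by case/andP=> p0 p1; apply: prodr_ge0 => e _; case: ifP => _ //; rewrite subr_ge0.
Qed.

(* The tournament whose arc j -> i (for i < j) is present iff [f (i, j)]. *)
Definition orient_set (n : nat) (f : {ffun 'I_n * 'I_n -> bool}) :
    {set 'I_n * 'I_n} :=
  [set e : 'I_n * 'I_n | if (e.1 < e.2)%N then ~~ f e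
           else (e.2 < e.1)%N && f (e.2, e.1)].

Lemma orient_setP (n : nat) (f : {ffun 'I_n * 'I_n -> bool}) :
  is_tournament (orient_set f).
Proof.
apply/forallP => i; apply/forallP => j; rewrite !inE /=.
case: eqVneq => [-> | ij]; first by rewrite ltnn.
by case: (ltngtP i j) => [_ | _ | /val_inj /eqP]; rewrite ?(negbTE ij) //=; case: (f _).
Qed.

Lemma tournament_prob_total (R : realType) (n : nat) (p : R) :
  tournament_prob p (fun T : tournament n => true) = 1.
Proof.
pose P (e : 'I_n * 'I_n) := (e.1 < e.2)%N.
pose F (e : 'I_n * 'I_n) (b : bool) : R := if b then p else 1 - p.
have <- : \prod_(e | P e) \sum_(b : bool) F e b = 1.
  by apply: big1 => e _; rewrite big_bool /F /= addrC subrK.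
rewrite (big_distr_big_dep false) /=.
pose h f := Tournament (@orient_setP n f).
pose g (T : tournament n) : {ffun 'I_n * 'I_n -> bool} :=
  [ffun e => P e && arc T e.2 e.1].
rewrite /tournament_prob (reindex_onto h g) /=; last first.
  move=> T _; apply: val_inj; apply/setP => -[i j]; rewrite !inE !ffunE /P /arc /=.
  have /forallP/(_ i)/forallP/(_ j) := arcsP T.
  case: (ltngtP i j) => [ij | // | /val_inj ->] /=.
    by rewrite -val_eqE (ltn_eqF ij); do 2!case: (_ \in _).
  by rewrite eqxx => /negbTE.
have arch f (e : 'I_n * 'I_n) : P e -> arc (h f) e.2 e.1 = f e.
  by move=> Pe; rewrite /arc inE /= ltnNge ltnW //= (Pe : (_ < _)%N); case: e Pe.
apply: eq_big => [f | f _]; last by apply: eq_bigr => e Pe; rewrite /F arch.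
apply/eqP/pfamilyP => [<- | [/supportP sf _]].
  by split => //; apply/supportP => e nPe; rewrite ffunE (negbTE (nPe : ~~ P e)).
apply/ffunP => e; rewrite ffunE; case Pe: (P e) => /=; first exact: arch.
by apply/esym/sf; apply: negbT; exact: Pe.
Qed.

(* Main.v *)
(* [chi > k]: some colour class contains a transitive set [S] of size
   [s = ceil(n / k)].  A triple of vertices is cyclic with probability exactly
   [p (1 - p)], and [S] contains of the order of [s ^ 2] pairwise edge-disjoint
   triples, so [S] is transitive with probability at most
   [exp (- c p (1 - p) s ^ 2)]; this beats the [(3 k) ^ s] choices of [S] once
   [p (1 - p) n] is of the order of [k ln k].

   [chi <= k]: a set spanning no back arc is transitive, so it suffices to
   colour properly the graph of back arcs, which is [G(n, d / n)].  First
   moments show that w.h.p. few vertices lie in triangles, every set [S] of size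
   at least [eps n] spans [O(|S| ^ 2 d / n)] edges, and every smaller set spans
   few edges.  By Shearer's argument a triangle-free graph of maximum degree
   [D] has an independent set of relative size [log D / D], so about [d / log d]
   independent sets exhaust all but [eps n] vertices; the remaining vertices,
   with those in triangles, induce a degenerate graph.  When [k] is small,
   [d = 1 / 6] makes the whole graph 2-degenerate. *)
Require Import Defs.
From HB Require Import structures.
From mathcomp Require Import all_boot all_order all_algebra.
From mathcomp Require Import ring lra zify.

Set Implicit Arguments.
Unset Strict Implicit.
Unset Printing Implicit Defensive.

Import Order.TTheory GRing.Theory Num.Theory.

(** * Independent sets and colourings of finite graphs *)

Definition indep (T : finType) (e : rel T) (I : {set T}) : bool :=
  [forall x in I, forall y in I, ~~ e x y].

Lemma indepP (T : finType) (e : rel T) (I : {set T}) :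
  reflect {in I &, forall x y, ~~ e x y} (indep e I).
Proof.
apply: (iffP forall_inP) => [h x y xI yI | h x xI].
  exact: (forall_inP (h x xI)).
by apply/forall_inP => y yI; exact: h.
Qed.

Definition nbrs (T : finType) (e : rel T) (S : {set T}) (v : T) : {set T} :=
  [set u in S | e v u].

(** Greedy colouring: set aside a vertex with at most [m] neighbours in [U], colour the rest by
    induction, and give it one of the [m.+1] colours that its neighbours leave free. *)
Lemma degenerate_coloring (T : finType) (e : rel T) (m : nat) (U : {set T}) :
  symmetric e -> irreflexive e ->
  (forall S : {set T}, S \subset U -> S != set0 ->
     exists2 v, v \in S & #|nbrs e S v| <= m) ->
  exists f : T -> 'I_m.+1, {in U &, forall x y, e x y -> f x != f y}.
Proof.
move=> sym irr; move: {2}#|U| (erefl #|U|) => n.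
elim: n U => [|n IH] U cU degU.
  exists (fun=> ord0) => x y; move/eqP: cU; rewrite cards_eq0 => /eqP ->.
  by rewrite inE.
have [|v vU dv] := degU U (subxx _); first by rewrite -card_gt0 cU.
have [||f fP] := IH (U :\ v).
- by have := cardsD1 v U; rewrite vU cU add1n => -[].
- by move=> S SU; apply: degU; exact: subset_trans SU (subsetDl _ _).
have [c cN] : exists c, c \notin f @: nbrs e U v.
  apply/existsP; apply: contraT => /existsPn h.
  have : #|'I_m.+1| <= #|f @: nbrs e U v|.
    by rewrite -cardsT subset_leq_card //; apply/subsetP => c _; have := h c; rewrite negbK.
  by rewrite card_ord leqNgt ltnS (leq_trans (leq_imset_card _ _) dv).
have nc y : y \in U -> e v y -> f y != c.
  move=> yU evy; apply: contraNneq cN => <-; apply: imset_f.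
  by rewrite inE yU.
exists (fun x => if x == v then c else f x) => x y xU yU exy.
case: (eqVneq x v) exy => [-> | xv] exy.
  case: (eqVneq y v) exy => [-> | yv] exy; first by rewrite irr in exy.
  by rewrite eq_sym; exact: nc.
case: (eqVneq y v) exy => [-> | yv] exy; first by apply: nc => //; rewrite sym.
by apply: fP; rewrite // !inE ?xv ?yv.
Qed.

(** Complementation in [X] is an involution of the powerset, and [Y] together with its complement
    has [#|X|] elements. *)
Lemma sum_card_powerset (T : finType) (X : {set T}) :
  2 * \sum_(Y in powerset X) #|Y| = #|X| * 2 ^ #|X|.
Proof.
rewrite mul2n -addnn.
have {1}-> : \sum_(Y in powerset X) #|Y| = \sum_(Y in powerset X) #|X :\: Y|.
  rewrite (reindex_onto (fun Y => X :\: Y) (fun Y => X :\: Y)) /=.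
    apply: eq_big => [Y | //]; rewrite !powersetE subsetDl /=.
    by rewrite setDDr setDv set0U; apply/eqP/idP => [<- | /setIidPr //]; exact: subsetIl.
  by move=> Y; rewrite powersetE setDDr setDv set0U => /setIidPr.
rewrite -big_split /= (eq_bigr (fun=> #|X|)) => [|Y].
  by rewrite sum_nat_const card_powerset mulnC.
rewrite powersetE => /setIidPr YX.
by rewrite addnC -{1}YX cardsID.
Qed.

(** The numerical core of [shearer_local]: the left side is twice [L] times the size of a fibre, the
    right side bounds twice its weight from below. For [x >= 2 * L] the term [x * 2 ^ x] dominates;
    otherwise [2 ^ x < 4 ^ L], and [D >= 8 ^ L] leaves a factor [2 ^ L] to beat [L]. *)
Lemma shearer_ineq (D L x : nat) : 8 ^ L <= D ->
  2 * (L * (2 ^ x + 1)) <= 2 * D + x * 2 ^ x.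
Proof.
move=> LD; have [xL | Lx] := leqP (2 * L) x.
  have h : 2 * L * 2 ^ x <= x * 2 ^ x by rewrite leq_mul2r xL orbT.
  have := ltn_expl L (isT : 1 < 8); lia.
suff : 2 * (L * (2 ^ x + 1)) <= 2 * 8 ^ L by lia.
case: L Lx {LD} => // L Lx.
have : 2 ^ x <= 2 * 4 ^ L.
  by rewrite -[4]/(2 ^ 2) -expnM -expnS leq_exp2l //; lia.
have := ltn_expl L (isT : 1 < 2).
have : 0 < 4 ^ L by rewrite expn_gt0.
have -> : 8 ^ L.+1 = 8 * (2 ^ L * 4 ^ L) by rewrite expnS -expnMn.
move: (2 ^ L) (4 ^ L) (2 ^ x) => a b c; nia.
Qed.

(** * Large independent sets in locally sparse graphs, after Shearer *)

Section Shearer.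
Variables (T : finType) (e : rel T) (S : {set T}).
Hypotheses (sym : symmetric e) (irr : irreflexive e).
Hypothesis tri : {in S & &, forall x y z, e x y -> e y z -> ~~ e x z}.

Let indeps : {set {set T}} := [set I : {set T} | (I \subset S) && indep e I].

(* Conditioning on the part [J] of [I] outside the closed neighbourhood of [v]:
   by triangle-freeness, [I] is then [v |: J], or [J :|: Y] with [Y] an
   arbitrary set of neighbours of [v] having no neighbour in [J]. *)
Lemma shearer_local (D L : nat) (v : T) : 8 ^ L <= D -> v \in S ->
  L * #|indeps| <= \sum_(I in indeps) (D * (v \in I) + #|nbrs e S v :&: I|).
Proof.
move=> LD vS; set N := nbrs e S v; pose M := v |: N.
have vN : v \notin N by rewrite inE irr andbF.
rewrite mulnC -sum_nat_const.
rewrite (partition_big (fun I => I :\: M) predT) //=.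
rewrite [leqRHS](partition_big (fun I => I :\: M) predT) //=.
apply: leq_sum => J _.
pose fib := [set I in indeps | I :\: M == J].
have fibE (F : {set T} -> nat) :
    \sum_(I in indeps | I :\: M == J) F I = \sum_(I in fib) F I.
  by apply: eq_bigl => I; rewrite [RHS]inE.
rewrite !fibE.
(* A member of the fibre certifies that [J] is independent, lies in [S] and avoids the closed
   neighbourhood [M]. *)
have [-> | [I0 I0f]] := set_0Vmem fib; first by rewrite big_set0.
move: I0f; rewrite !inE => /andP[/andP[I0S /indepP I0i] /eqP JE].
have JS : J \subset S by rewrite -JE (subset_trans (subsetDl _ _)).
have JM u : u \in J -> u \notin M by rewrite -JE inE => /andP[].
have Ji : {in J &, forall x y, ~~ e x y}.
  by move=> x y; rewrite -JE !inE => /andP[_ xI] /andP[_ yI]; exact: I0i.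
have vJ : v \notin J by apply/negP => /JM; rewrite !inE eqxx.
pose X := [set u in N | [forall w in J, ~~ e u w]].
have XN : X \subset N by apply/subsetP => u; rewrite inE => /andP[].
have NJ : [disjoint N & J].
  rewrite disjoint_sym disjoints_subset; apply/subsetP => u /JM.
  by rewrite !inE negb_or => /andP[_ ->].
have JY (Y : {set T}) : Y \subset X -> (J :|: Y) :&: N = Y.
  move=> YX; rewrite setIUl [J :&: N]setIC (disjoint_setI0 NJ) set0U.
  by apply/setIidPl; exact: subset_trans YX XN.
have fibE1 : fib = (fun Y => J :|: Y) @: powerset X :|: [set v |: J].
  apply/setP => I; rewrite !inE; apply/idP/orP.
    case/andP=> /andP[IS /indepP Ii] /eqP IJ; case vI : (v \in I).
      right; apply/eqP/setP => u; rewrite !inE -IJ !inE.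
      case: eqVneq => [-> // | uv] /=; case uI : (u \in I); rewrite ?andbF //.
      by have := Ii v u vI uI; rewrite (subsetP IS u uI) => /negbTE ->.
    left; apply/imsetP; exists (I :&: N).
      rewrite powersetE; apply/subsetP => u; rewrite !inE => /and3P[uI uS ->].
      rewrite uS /=; apply/forall_inP => w; rewrite -IJ inE => /andP[_ wI].
      exact: Ii.
    apply/setP => u; rewrite -IJ !inE.
    by case: eqVneq => [-> | uv]; rewrite ?vI //=; case: (u \in I); case: (u \in S); case: (e v u).
  case=> [/imsetP[Y] | /eqP ->].
    rewrite powersetE => YX ->{I}.
    have YS : Y \subset S.
      by apply/subsetP => u /(subsetP YX); rewrite !inE => /andP[/andP[]].
    rewrite subUset JS YS /=; apply/andP; split.
      have YJ x y : x \in Y -> y \in J -> ~~ e x y.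
        by move=> /(subsetP YX); rewrite inE => /andP[_ /forall_inP]; apply.
      apply/indepP => x y; rewrite !inE => /orP[xJ | xY] /orP[yJ | yY].
      - exact: Ji.
      - by rewrite sym YJ.
      - exact: YJ.
      have /andP[/andP[xS vx] _] : (x \in S) && e v x && true.
        by have := subsetP XN x (subsetP YX x xY); rewrite inE => ->.
      have /andP[/andP[yS vy] _] : (y \in S) && e v y && true.
        by have := subsetP XN y (subsetP YX y yY); rewrite inE => ->.
      by apply: (tri xS vS yS) => //; rewrite sym.
    apply/eqP/setP => u; rewrite in_setD in_setU.
    case uJ : (u \in J); first by rewrite JM.
    case uY : (u \in Y) => /=; last by rewrite andbF.
    by rewrite !inE; have := subsetP XN u (subsetP YX u uY); rewrite inE => ->; rewrite orbT.
  rewrite subUset sub1set vS JS /=; apply/andP; split.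
    have vJe y : y \in J -> ~~ e v y.
      by move=> yJ; have := JM y yJ; rewrite !inE negb_or (subsetP JS y yJ) => /andP[].
    apply/indepP => x y; rewrite !inE => /orP[/eqP -> | xJ] /orP[/eqP -> | yJ].
    - by rewrite irr.
    - exact: vJe.
    - by rewrite sym vJe.
    exact: Ji.
  apply/eqP/setP => u; rewrite in_setD in_setU1.
  case uJ : (u \in J); first by rewrite JM ?orbT.
  by case: eqVneq => [-> | ]; rewrite ?andbF //= !inE eqxx.
have injJ : {in powerset X &, injective (fun Y => J :|: Y)}.
  by move=> Y Z; rewrite !powersetE => /JY {2}<- /JY {2}<- ->.
have vJX : v |: J \notin (fun Y => J :|: Y) @: powerset X.
  apply/imsetP => -[Y]; rewrite powersetE => YX.
  move/setP/(_ v); rewrite !inE eqxx (negbTE vJ) /= => vY.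
  by move: vN; rewrite (subsetP (subset_trans YX XN)).
rewrite fibE1 setUC !big_setU1 //= !big_imset //= sum_nat_const card_powerset.
rewrite !in_setU1 eqxx /=.
have -> : \sum_(Y in powerset X) (D * (v \in J :|: Y) + #|N :&: (J :|: Y)|) =
          \sum_(Y in powerset X) #|Y|.
  apply: eq_bigr => Y; rewrite powersetE => YX; rewrite setIC JY // in_setU (negbTE vJ).
  by rewrite (contraNF (subsetP (subset_trans YX XN) v) vN) muln0.
(* The set [v |: J] weighs at least [D], and the [2 ^ #|X|] sets [J :|: Y] weigh [#|Y|] each, on
   average [#|X| / 2]. *)
have := shearer_ineq #|X| LD; have := sum_card_powerset X.
lia.
Qed.

(** Sum [shearer_local] over [v] in [S] and exchange the sums: each independent [I] receives
    [D * #|I|] from its members and at most [D * #|I|] from edges leaving it. So [2 * D * #|I|] is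
    on average at least [L * #|S|]. *)
Theorem shearer (D L : nat) :
  {in S, forall v, #|nbrs e S v| <= D} -> 8 ^ L <= D ->
  exists I : {set T}, [/\ I \subset S, indep e I & L * #|S| <= 2 * D * #|I|].
Proof.
move=> degS LD; pose good (I : {set T}) := L * #|S| <= 2 * D * #|I|.
case: (boolP [exists I in indeps, good I]) => [/exists_inP[I] | /exists_inPn h].
  by rewrite inE => /andP[IS Ii] gI; exists I.
(* The family is nonempty, so if every member fell short the sums would compare strictly. *)
have i0 : set0 \in indeps.
  by rewrite inE sub0set; apply/indepP => x; rewrite inE.
have lt : \sum_(I in indeps) 2 * D * #|I| < \sum_(I in indeps) L * #|S|.
  rewrite (bigD1 set0) //= [ltnRHS](bigD1 set0) //= -addSn leq_add //.
    by have := h _ i0; rewrite /good -ltnNge.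
  by apply: leq_sum => I /andP[/h]; rewrite /good -ltnNge => /ltnW.
have : \sum_(v in S) L * #|indeps| <=
       \sum_(v in S) \sum_(I in indeps) (D * (v \in I) + #|nbrs e S v :&: I|).
  by apply: leq_sum => v; exact: shearer_local.
rewrite exchange_big /= leqNgt sum_nat_const => /negP[].
apply: leq_trans (_ : _ < \sum_(I in indeps) L * #|S|) _; last first.
  by rewrite sum_nat_const mulnCA [leqRHS]mulnCA [#|indeps| * _]mulnC.
apply: leq_ltn_trans lt; apply: leq_sum => I; rewrite inE => /andP[IS _].
rewrite big_split /= -big_distrr /=.
have -> : \sum_(v in S) (v \in I) = #|I|.
  rewrite -big_mkcondr -sum1_card; apply: eq_bigl => v.
  exact/andb_idl/(subsetP IS).
suff : \sum_(v in S) #|nbrs e S v :&: I| <= \sum_(u in I) D.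
  by rewrite sum_nat_const; lia.
(* Count the pairs from the side of [I]: each [u] in [I] has at most [D] neighbours in [S]. *)
under eq_bigr => v _ do rewrite -sum1_card.
rewrite (exchange_big_dep (mem I)) /=; last by move=> v u _; rewrite inE => /andP[].
apply: leq_sum => u uI; rewrite sum1_card; apply: leq_trans (degS u (subsetP IS u uI)).
apply: subset_leq_card; apply/subsetP => v; rewrite unfold_in !inE.
by rewrite sym => /andP[-> /andP[/andP[_ ->]]].
Qed.
End Shearer.

(** By Markov's inequality on degrees, at least half of [S] has degree at most [D]; [shearer]
    applied to that half costs the extra factor 2. *)
Lemma sparse_indep (T : finType) (e : rel T) (S : {set T}) (D L : nat) :
  symmetric e -> irreflexive e ->
  {in S & &, forall x y z, e x y -> e y z -> ~~ e x z} ->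
  2 * \sum_(v in S) #|nbrs e S v| <= D.+1 * #|S| -> 8 ^ L <= D ->
  exists I : {set T}, [/\ I \subset S, indep e I & L * #|S| <= 4 * D * #|I|].
Proof.
move=> sym irr tri avg LD.
pose S' := [set v in S | #|nbrs e S v| <= D].
have S'S : S' \subset S by apply/subsetP => v; rewrite inE => /andP[].
have half : #|S| <= 2 * #|S'|.
  have : D.+1 * #|S :\: S'| <= \sum_(v in S) #|nbrs e S v|.
    rewrite mulnC -sum_nat_const [leqRHS](big_setID S') /= -[leqLHS]add0n.
    rewrite leq_add // [leqRHS](eq_bigl (mem (S :\: S'))) //.
    by apply: leq_sum => v; rewrite !inE; case: (v \in S); rewrite ?andbF // ltnNge andbT.
  have := cardsID S' S; rewrite (setIidPr S'S).
  by nia.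
have [|v|I [IS' Ii LI]] := shearer (S := S') sym irr _ _ LD.
- by move=> x y z /(subsetP S'S) xS /(subsetP S'S) yS /(subsetP S'S) zS; exact: tri.
- rewrite inE => /andP[_]; apply: leq_trans; apply/subset_leq_card/subsetP => u.
  by rewrite !inE => /andP[/andP[-> _] ->].
exists I; split => //; first exact: subset_trans IS' S'S.
have : L * #|S| <= L * (2 * #|S'|) by rewrite leq_mul2l half orbT.
by lia.
Qed.

(** * Assembling colourings from independent sets and a remainder *)

Local Open Scope ring_scope.

(** Independent sets of size at least [a] are removed while at least [s] vertices remain. The final
    disjunction tells whether the process stopped early or completed all [j] rounds. *)
Lemma greedy_classes (R : realDomainType) (T : finType) (e : rel T)
    (U : {set T}) (s a : R) (j : nat) :
  symmetric e ->
  (forall S : {set T}, S \subset U -> s <= #|S|%:R ->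
     exists I : {set T}, [/\ I \subset S, indep e I & a <= #|I|%:R]) ->
  exists (W : {set T}) (f : T -> nat),
    [/\ W \subset U,
        {in U :\: W, forall x, (f x < j)%N},
        {in U :\: W &, forall x y, e x y -> f x != f y}
      & #|W|%:R < s \/ #|W|%:R + j%:R * a <= #|U|%:R].
Proof.
move=> sym ext; elim: j => [|j [W [f [WU fj fP Wle]]]].
  by exists U, (fun=> 0%N); split => [|x|x y|]; rewrite ?setDv ?inE //; right; rewrite mul0r addr0.
have [Ws | sW] := ltP (#|W|%:R : R) s.
  by exists W, f; split => // [x xU|]; [rewrite ltnS ltnW ?fj | left].
have {}Wle : #|W|%:R + j%:R * a <= #|U|%:R :> R by case: Wle => //; rewrite ltNge sW.
have [I [IW /indepP Ii aI]] := ext W WU sW.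
exists (W :\: I), (fun x => if x \in I then j else f x).
have UW x : x \in U :\: (W :\: I) -> x \notin I -> x \in U :\: W.
  by rewrite !inE => /andP[h ->] xI; rewrite xI /= andbT in h *.
split.
- exact: subset_trans (subsetDl _ _) WU.
- move=> x xU; case: (boolP (x \in I)) => // xI.
  by rewrite ltnS ltnW // fj // UW.
- move=> x y xU yU exy.
  case: (boolP (x \in I)) => xI; case: (boolP (y \in I)) => yI.
  + by have := Ii x y xI yI; rewrite exy.
  + by rewrite gtn_eqF // fj // UW.
  + by rewrite ltn_eqF // fj // UW.
  + by apply: fP; rewrite // UW.
- right; rewrite (cardsD W I) (setIidPr IW) natrB ?subset_leq_card // mulrSr mulrDl mul1r.
  lra.
Qed.

Lemma glue_coloring (T : finType) (e : rel T) (A : {set T}) (j m k : nat)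
    (f : T -> nat) (g : T -> 'I_m.+1) :
  {in A, forall x, (f x < j)%N} -> {in A &, forall x y, e x y -> f x != f y} ->
  {in ~: A &, forall x y, e x y -> g x != g y} -> (j + m.+1 <= k)%N ->
  exists h : {ffun T -> 'I_k}, forall x y, e x y -> h x != h y.
Proof.
move=> fj fP gP jmk.
have hk x : ((if x \in A then f x else j + g x) < k)%N.
  case: ifP => [/fj fx|_]; first by apply: leq_trans jmk; rewrite (leq_trans fx) // leq_addr.
  by apply: leq_trans jmk; rewrite ltn_add2l.
exists [ffun x => Ordinal (hk x)] => x y exy; rewrite !ffunE -val_eqE /=.
case: ifPn => xA; case: ifPn => yA.
- exact: fP.
- by rewrite ltn_eqF // (leq_trans (fj x xA)) ?leq_addr.
- by rewrite gtn_eqF // (leq_trans (fj y yA)) ?leq_addr.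
- by rewrite eqn_add2l; apply: gP; rewrite ?inE.
Qed.

(** * Products of Bernoulli distributions *)

From mathcomp Require Import all_classical all_reals all_analysis.
Import numFieldNormedType.Exports.

Section Bernoulli.
Variables (R : realFieldType) (I : finType) (q : I -> R).
Implicit Types (f g : {ffun I -> bool}) (E F : pred {ffun I -> bool}).

Definition bern_weight f : R := \prod_i (if f i then q i else 1 - q i).

Definition bern_prob E : R := \sum_(f | E f) bern_weight f.

Lemma bern_prob_family (Q : I -> pred bool) :
  bern_prob (fun f => [forall i, Q i (f i)]) =
  \prod_i \sum_(b | Q i b) (if b then q i else 1 - q i).
Proof. by rewrite bigA_distr_big_dep. Qed.

Lemma bern_prob_total : bern_prob xpredT = 1.
Proof.
have <- : \prod_i \sum_(b | true) (if b then q i else 1 - q i) = 1.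
  by apply: big1 => i _; rewrite big_bool /= addrC subrK.
rewrite -bern_prob_family; apply: eq_bigl => f; exact/esym/forallP.
Qed.

Lemma bern_prob_pattern (A : {set I}) (b : I -> bool) :
  bern_prob (fun f => [forall i in A, f i == b i]) =
  \prod_(i in A) (if b i then q i else 1 - q i).
Proof.
have := bern_prob_family (fun i c => (i \in A) ==> (c == b i)).
rewrite /bern_prob => ->; rewrite [RHS]big_mkcond /=.
apply: eq_bigr => i _; case: ifP => iA /=.
  by rewrite big_pred1_eq.
by rewrite big_bool /= addrC subrK.
Qed.

Hypothesis q01 : forall i, 0 <= q i <= 1.

Lemma bern_weight_ge0 f : 0 <= bern_weight f.
Proof.
by apply: prodr_ge0 => i _; case/andP: (q01 i) => q0 q1; case: ifP; rewrite ?subr_ge0.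
Qed.

Lemma bern_prob_le E F : (forall f, E f -> F f) -> bern_prob E <= bern_prob F.
Proof.
move=> EF; rewrite /bern_prob big_mkcond [leRHS]big_mkcond.
apply: ler_sum => f _; case: ifP => [/EF -> // | _].
by case: ifP => // _; exact: bern_weight_ge0.
Qed.

Lemma bern_prob_union (J : finType) (P : pred J) (E : J -> pred {ffun I -> bool}) :
  bern_prob (fun f => [exists j in P, E j f]) <= \sum_(j in P) bern_prob (E j).
Proof.
rewrite /bern_prob; under [leRHS]eq_bigr => j _ do rewrite big_mkcond.
rewrite exchange_big [leLHS]big_mkcond /=; apply: ler_sum => f _.
have ge0 j : 0 <= (if E j f then bern_weight f else 0).
  by case: ifP => // _; exact: bern_weight_ge0.
case: ifP => [/exists_inP[j Pj Ej] | _]; last by apply: sumr_ge0.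
by rewrite (bigD1 j) //= Ej lerDl sumr_ge0.
Qed.

Lemma bern_prob_all (A : {set I}) :
  bern_prob (fun f => [forall i in A, f i]) = \prod_(i in A) q i.
Proof.
rewrite -(bern_prob_pattern A xpredT); apply: eq_bigl => f.
by apply: eq_forallb => i; rewrite eqb_id.
Qed.

Lemma bern_prob_compl E : bern_prob (fun f => ~~ E f) = 1 - bern_prob E.
Proof.
rewrite -bern_prob_total /bern_prob [in RHS](bigID E) /=.
by rewrite addrC addrK.
Qed.

Definition determined_by (A : {set I}) E :=
  forall f g, {in A, f =1 g} -> E f = E g.

(* Swapping the coordinates outside [A] of two independent copies preserves
   the product weight. *)
Lemma bern_prob_indep2 (A B : {set I}) E F : [disjoint A & B] ->
  determined_by A E -> determined_by B F ->
  bern_prob (fun f => E f && F f) = bern_prob E * bern_prob F.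
Proof.
move=> AB EA FB; rewrite -[LHS]mulr1 -bern_prob_total /bern_prob.
rewrite !big_distrlr /= !pair_big /=.
pose mix (f g : {ffun I -> bool}) : {ffun I -> bool} := [ffun i => if i \in A then f i else g i].
pose sw (u : {ffun I -> bool} * {ffun I -> bool}) := (mix u.1 u.2, mix u.2 u.1).
have swK : involutive sw.
  by case=> f g; congr (_, _); apply/ffunP => i; rewrite !ffunE; case: ifP => ->.
rewrite (reindex_inj (inv_inj swK)) /=; apply: eq_big => [[f g] | [f g] _] /=.
  rewrite andbT (EA _ f) => [|i iA]; last by rewrite ffunE iA.
  congr (_ && _); apply: FB => i iB; rewrite ffunE ifN //.
  by apply: contraTN iB => iA; rewrite (disjointFr AB).
rewrite /bern_weight -!big_split /=; apply: eq_bigr => i _; rewrite !ffunE.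
by case: (i \in A) => //; rewrite mulrC.
Qed.

Lemma bern_prob_indep (J : finType) (A : J -> {set I}) (E : J -> pred {ffun I -> bool}) :
  (forall i j, i != j -> [disjoint A i & A j]) ->
  (forall j, determined_by (A j) (E j)) ->
  bern_prob (fun f => [forall j, E j f]) = \prod_j bern_prob (E j).
Proof.
move=> dis det.
suff H (s : seq J) : uniq s ->
    bern_prob (fun f => all (fun j => E j f) s) = \prod_(j <- s) bern_prob (E j).
  rewrite -big_enum /= -H ?enum_uniq //; apply: eq_bigl => f.
  by apply/forallP/allP => [h j _ | h j]; rewrite ?h ?mem_enum.
elim: s => [_|j s IH /=/andP[js us]]; first by rewrite big_nil bern_prob_total.
rewrite big_cons -IH //.
apply: (@bern_prob_indep2 (A j) (\bigcup_(i in s) A i)) => //.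
  apply: bigcup_disjoint => i si; apply: dis.
  by apply: contraNneq js => ->.
move=> f g fg; apply: eq_in_all => i si; apply: det => x xA; apply: fg.
by apply/bigcupP; exists i.
Qed.

End Bernoulli.

(** Markov's inequality for the number of events that occur, whose expectation is the right-hand
    side. *)
Lemma bern_card_markov (R : realFieldType) (I J : finType) (q : I -> R)
    (E : J -> pred {ffun I -> bool}) (b : R) : (forall i, 0 <= q i <= 1) ->
  b * bern_prob q (fun f => b <= #|[set j | E j f]|%:R) <= \sum_j bern_prob q (E j).
Proof.
move=> q01; rewrite /bern_prob; under [leRHS]eq_bigr => j _ do rewrite big_mkcond.
rewrite exchange_big /= [in leLHS]big_mkcond big_distrr /=; apply: ler_sum => f _.
have -> : \sum_j (if E j f then bern_weight q f else 0) =
          #|[set j | E j f]|%:R * bern_weight q f.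
  rewrite -big_mkcond /= mulr_natl -sumr_const; apply: eq_bigl => j; by rewrite inE.
case: ifP => h; last by rewrite mulr0 mulr_ge0 ?bern_weight_ge0.
by rewrite ler_wpM2r ?bern_weight_ge0.
Qed.

Lemma bern_prob_disjoint (R : realFieldType) (I : finType) (q : I -> R)
    (E F : pred {ffun I -> bool}) : (forall f, E f -> ~~ F f) ->
  bern_prob q (fun f => E f || F f) = bern_prob q E + bern_prob q F.
Proof.
move=> EF; rewrite /bern_prob (bigID E) /=; congr (_ + _); apply: eq_bigl => f.
  by case: (E f); rewrite ?andbF.
by case Ef: (E f); rewrite /= ?andbT // (negbTE (EF f Ef)).
Qed.

Lemma bern_prob_le1 (R : realFieldType) (I : finType) (q : I -> R) E :
  (forall i, 0 <= q i <= 1) -> bern_prob q E <= 1.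
Proof. by move=> q01; rewrite -(bern_prob_total q) bern_prob_le. Qed.

(** * The graph of back arcs *)

(* The coordinates [(i, j)] with [i >= j] carry no arc and are almost surely
   [false]. *)
Definition pair_prob (R : realFieldType) (n : nat) (p : R) (e : 'I_n * 'I_n) : R :=
  if (e.1 < e.2)%N then p else 0.

Definition tournament_of (n : nat) (f : {ffun 'I_n * 'I_n -> bool}) : tournament n :=
  Tournament (orient_setP f).

Lemma pair_prob01 (R : realFieldType) (n : nat) (p : R) (e : 'I_n * 'I_n) :
  0 <= p <= 1 -> 0 <= pair_prob p e <= 1.
Proof. by rewrite /pair_prob; case: ifP => // _ _; rewrite lexx ler01. Qed.

Lemma arc_tournament_of n (f : {ffun 'I_n * 'I_n -> bool}) (i j : 'I_n) :
  Defs.arc (tournament_of f) i j = if (i < j)%N then ~~ f (i, j) else (j < i)%N && f (j, i).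
Proof. by rewrite /Defs.arc inE. Qed.

(** Many configurations give the same tournament, but only the one that is [false] off the
    increasing pairs can have nonzero weight, since [pair_prob] vanishes there. *)
Lemma tournament_prob_bern (R : realType) (n : nat) (p : R) (E : pred (tournament n)) :
  tournament_prob p E = bern_prob (@pair_prob R n p) (fun f => E (tournament_of f)).
Proof.
pose g (T : tournament n) : {ffun 'I_n * 'I_n -> bool} :=
  [ffun e : 'I_n * 'I_n => (e.1 < e.2)%N && Defs.arc T e.2 e.1].
have gK T : tournament_of (g T) = T.
  apply: val_inj; apply/setP => -[i j]; rewrite !inE !ffunE /Defs.arc /=.
  have /forallP/(_ i)/forallP/(_ j) := arcsP T.
  case: (ltngtP i j) => [ij | // | /val_inj ->] /=.
    by rewrite -val_eqE (ltn_eqF ij); do 2!case: (_ \in _).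
  by rewrite eqxx => /negbTE.
have gE f e : g (tournament_of f) e = (e.1 < e.2)%N && f e.
  by rewrite ffunE arc_tournament_of; case: ltngtP => //; case: e.
rewrite /tournament_prob (reindex_onto (@tournament_of n) g) => [|T _]; last exact: gK.
rewrite /bern_prob [RHS](bigID (fun f => g (tournament_of f) == f)) /= [X in _ = _ + X]big1.
  rewrite addr0; apply: eq_bigr => f /andP[_ /eqP fK].
  rewrite /tournament_mass /bern_weight big_mkcond /=; apply: eq_bigr => e _.
  rewrite /pair_prob arc_tournament_of -{3}fK gE.
  by case: ltngtP => //= _; rewrite ?subr0 //; case: e.
move=> f /andP[_ nfK]; have [e fe] : exists e, g (tournament_of f) e != f e.
  apply/existsP; apply: contraNT nfK => /existsPn h.
  by apply/eqP/ffunP => e; have := h e; rewrite negbK => /eqP.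
rewrite /bern_weight (bigD1 e) //= /pair_prob; move: fe; rewrite gE.
by case: ltnP => _; case: (f e) => //= _; rewrite mul0r.
Qed.

Definition back n (f : {ffun 'I_n * 'I_n -> bool}) : rel 'I_n :=
  fun x y => ((x < y)%N && f (x, y)) || ((y < x)%N && f (y, x)).

Lemma back_sym n (f : {ffun 'I_n * 'I_n -> bool}) : symmetric (back f).
Proof. by move=> x y; rewrite /back orbC. Qed.

Lemma back_irr n (f : {ffun 'I_n * 'I_n -> bool}) : irreflexive (back f).
Proof. by move=> x; rewrite /back ltnn. Qed.

Lemma chi_le_colorable n (T : tournament n) k : colorable T k -> (chi T <= k)%N.
Proof. by rewrite /chi; case: ex_minnP => m _; apply. Qed.

(* Without back arcs inside it, a colour class is ordered like [0, ..., n - 1]. *)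
Lemma back_coloring n (f : {ffun 'I_n * 'I_n -> bool}) k (h : {ffun 'I_n -> 'I_k}) :
  (forall x y, back f x y -> h x != h y) -> (chi (tournament_of f) <= k)%N.
Proof.
move=> hP; apply: chi_le_colorable; apply/existsP; exists h; apply/forallP => c.
have arcE x y : h x = c -> h y = c -> Defs.arc (tournament_of f) x y = (x < y)%N.
  move=> hx hy; have : ~~ back f x y by apply/negP => /hP; rewrite hx hy eqxx.
  by rewrite arc_tournament_of /back negb_or !negb_and; case: ltngtP => //= _; case: (f _).
apply/forall_inP => x; rewrite inE => /eqP hx; apply/forall_inP => y.
rewrite inE => /eqP hy; apply/forall_inP => z; rewrite inE => /eqP hz.
by rewrite !arcE //; apply/implyP => xy; apply/implyP; exact: ltn_trans.
Qed.

Definition back_edges n (f : {ffun 'I_n * 'I_n -> bool}) (S : {set 'I_n}) :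
    {set 'I_n * 'I_n} :=
  [set e : 'I_n * 'I_n | [&& (e.1 < e.2)%N, e.1 \in S, e.2 \in S & f e]].

(** Handshake lemma: [back_edges] lists each edge once, as an increasing pair, and the degrees count
    it from both ends. *)
Lemma sum_nbrs_back n (f : {ffun 'I_n * 'I_n -> bool}) (S : {set 'I_n}) :
  (\sum_(v in S) #|nbrs (back f) S v| = 2 * #|back_edges f S|)%N.
Proof.
pose B (x y : 'I_n) : nat := [&& (x < y)%N, x \in S, y \in S & f (x, y)].
have back_edgesE : (#|back_edges f S| = \sum_x \sum_y B x y)%N.
  rewrite pair_big /= -sum1_card big_mkcond /=; apply: eq_bigr => -[x y] _.
  by rewrite inE /B /=; case: ifP.
rewrite mul2n -addnn {1}back_edgesE [in X in (_ + X)%N]back_edgesE.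
rewrite [X in (_ + X)%N]exchange_big -big_split /= big_mkcond.
apply: eq_bigr => x _; rewrite -big_split /= -sum1_card.
case: ifP => xS; last by rewrite big1 // => y _; rewrite /B xS !andbF.
rewrite big_mkcond; apply: eq_bigr => y _; rewrite inE /B /back xS /=.
by case: (y \in S); case: ltngtP => //= _; rewrite ?orbF; case: (f _).
Qed.

(** With the constant configuration [true], [back_edges] is the set of all increasing pairs in [S],
    the pool from which edges are drawn in [dense_prob]. *)
Lemma card_pairs_le n (S : {set 'I_n}) :
  (2 * #|back_edges [ffun=> true] S| <= #|S| ^ 2)%N.
Proof.
rewrite -sum_nbrs_back -mulnn -sum_nat_const; apply: leq_sum => v _.
by apply: subset_leq_card; apply/fintype.subsetP => u; rewrite inE => /andP[].
Qed.

(** * First-moment bounds for dense spots *)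

Lemma expR1_le3 (R : realType) : expR 1 <= 3 :> R.
Proof.
(* The exponent 6 is large enough: [(5 / 6) ^+ 6] already exceeds [1 / 3]. *)
have h : 5 / 6 <= expR (- 6^-1) :> R by apply: le_trans (expR_ge1Dx _); lra.
have : (5 / 6) ^+ 6 <= expR (- 6^-1) ^+ 6 :> R by rewrite lerXn2r ?nnegrE ?expR_ge0 //; lra.
rewrite -expRM_natl mulrN mulfV ?pnatr_eq0 // expRN => h6.
by rewrite -[expR 1]invrK invf_ple ?posrE ?invr_gt0 ?expR_gt0 //; lra.
Qed.

(** A weak Stirling bound: the induction step is [(1 + 1 / r) ^+ r <= expR 1 <= 3]. *)
Lemma natX_le_fact (R : realType) (r : nat) :
  (r%:R : R) ^+ r <= 3 ^+ r * (r`!)%:R.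
Proof.
elim: r => [|r IH]; first by rewrite !expr0 mul1r.
suff h : (r.+1%:R : R) ^+ r <= 3 * r%:R ^+ r.
  rewrite exprS factS natrM [3 ^+ _]exprS mulrACA [3 * _]mulrC -mulrA.
  rewrite ler_wpM2l //; apply: le_trans h _; rewrite ler_wpM2l //.
case: r {IH} => [|r]; first by rewrite !expr0; lra.
have -> : (r.+2%:R : R) = (1 + r.+1%:R^-1) * r.+1%:R.
  by rewrite mulrDl mul1r mulVf ?pnatr_eq0 // [in LHS]mulrSr.
rewrite exprMn ler_wpM2r ?exprn_ge0 //; apply: le_trans (expR1_le3 R).
rewrite -[1 in leRHS](@mulfV _ (r.+1%:R : R)) ?pnatr_eq0 // expRM_natl.
by rewrite lerXn2r ?nnegrE ?expR_ge0 ?addr_ge0 // expR_ge1Dx.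
Qed.

Lemma bin_exp_le (R : realType) (M r : nat) (p : R) : 0 <= p -> (0 < r)%N ->
  'C(M, r)%:R * p ^+ r <= (3 * M%:R * p / r%:R) ^+ r.
Proof.
move=> p0 r0; have rr : 0 < r%:R ^+ r :> R by rewrite exprn_gt0 ?ltr0n.
have ffact_le : (M ^_ r <= M ^ r)%N.
  elim: (r) => [|j IH]; first by rewrite ffactn0.
  by rewrite ffactnSr expnSr leq_mul // leq_subr.
rewrite exprMn exprVn ler_pdivlMr // !exprMn [leLHS]mulrAC ler_wpM2r ?exprn_ge0 //.
apply: le_trans (_ : 'C(M, r)%:R * (3 ^+ r * (r`!)%:R) <= _).
  by rewrite ler_wpM2l // natX_le_fact.
rewrite mulrCA ler_wpM2l ?exprn_ge0 // -natrM bin_ffact -natrX ler_nat.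
exact: ffact_le.
Qed.

(** Union bound over the sets of [r] increasing pairs in [S], each wholly present with probability
    [p ^+ r]. *)
Lemma dense_prob (R : realType) n (p : R) (S : {set 'I_n}) (r : nat) :
  0 <= p <= 1 -> (0 < r)%N ->
  bern_prob (@pair_prob R n p) (fun f => r <= #|back_edges f S|)%N <=
  (3 * #|S|%:R ^+ 2 * p / (2 * r%:R)) ^+ r.
Proof.
move=> p01 r0; have [p0 p1] := andP p01.
have q01 e : 0 <= @pair_prob R n p e <= 1 by exact: pair_prob01.
pose E := back_edges [ffun=> true] S.
pose draws := [set F : {set 'I_n * 'I_n} | F \subset E & #|F| == r].
apply: le_trans (_ : bern_prob (@pair_prob R n p)
    (fun f => [exists F in draws, [forall e in F, f e]]) <= _).
  apply: bern_prob_le => // f rf.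
  have : (0 < #|[set F : {set 'I_n * 'I_n} | F \subset back_edges f S & #|F| == r]|)%N.
    by rewrite cards_draws bin_gt0.
  case/card_gt0P => F; rewrite inE => /andP[FS Fr]; apply/exists_inP; exists F.
    rewrite inE Fr andbT; apply/fintype.subsetP => e /(fintype.subsetP FS).
    by rewrite !inE ffunE => /and4P[-> -> -> _].
  by apply/forall_inP => e /(fintype.subsetP FS); rewrite inE => /and4P[].
apply: le_trans (bern_prob_union q01 _ _) _.
rewrite (eq_bigr (fun=> p ^+ r)) => [|F]; last first.
  rewrite inE => /andP[/fintype.subsetP FE /eqP <-]; rewrite bern_prob_all.
  rewrite -prodr_const; apply: eq_bigr => e /FE; rewrite inE /pair_prob.
  by case/andP => ->.
rewrite sumr_const cards_draws -[leLHS]mulr_natl; apply: le_trans (bin_exp_le _ p0 r0) _.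
rewrite lerXn2r ?nnegrE ?divr_ge0 ?mulr_ge0 ?exprn_ge0 //.
have r0' : r%:R != 0 :> R by rewrite pnatr_eq0 -lt0n.
have -> : 3 * #|E|%:R * p / r%:R = (2 * #|E|%:R) * (3 * p / (2 * r%:R)) by field.
have -> : 3 * #|S|%:R ^+ 2 * p / (2 * r%:R) = #|S|%:R ^+ 2 * (3 * p / (2 * r%:R)) by field.
by rewrite ler_wpM2r ?divr_ge0 ?mulr_ge0 // -natrX -natrM ler_nat card_pairs_le.
Qed.

Lemma sum_half_pow (R : realFieldType) (N : nat) : \sum_(s < N) (2^-1 : R) ^+ s <= 2.
Proof.
suff -> : \sum_(s < N) (2^-1 : R) ^+ s = 2 - 2 * 2^-1 ^+ N.
  by rewrite gerBl mulr_ge0 ?exprn_ge0 // invr_ge0.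
elim: N => [|N IH]; first by rewrite big_ord0 expr0 mulr1 subrr.
by rewrite big_ord_recr /= IH exprS; field.
Qed.

(* The exponent of the edge factor is only bounded below by [3 s / 2], hence the
   comparison of squares and the square root. *)
Lemma sparse_term (R : realType) (d eps p : R) (m n s : nat) :
  (2 < m)%N -> (0 < s)%N -> (0 < n)%N -> s%:R <= eps * n%:R ->
  3 * eps * d <= m%:R -> 243 * (d / m%:R) ^+ 3 * eps <= 16^-1 ->
  0 <= d -> 0 <= p -> p <= d / n%:R ->
  'C(n, s)%:R * (3 * s%:R ^+ 2 * p / (2 * (uphalf (m * s))%:R)) ^+ (uphalf (m * s))
  <= 4 * Num.sqrt (243 * (d / m%:R) ^+ 3 / n%:R) * 2^-1 ^+ s.
Proof.
move=> m2 s0 n0.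
set r := uphalf (m * s); have mr : (m * s <= 2 * r)%N by rewrite /r; lia.
have r0 : (0 < r)%N by nia.
move=> sn; set A := 243 * _ ^+ 3 => epsd Aeps d0 p0 pd.
have A0 : 0 <= A by rewrite mulr_ge0 ?exprn_ge0 ?divr_ge0 ?ler0n.
have n0' : 0 < n%:R :> R by rewrite ltr0n.
have m0' : 0 < m%:R :> R by rewrite ltr0n (leq_trans _ m2).
have s0' : 0 < s%:R :> R by rewrite ltr0n.
have r0' : 0 < r%:R :> R by rewrite ltr0n.
pose be := 3 * s%:R * d / (n%:R * m%:R).
have be0 : 0 <= be by rewrite divr_ge0 ?mulr_ge0.
have be1 : be <= 1.
  rewrite ler_pdivrMr ?mulr_gt0 // mul1r.
  apply: le_trans (_ : 3 * (eps * n%:R) * d <= _); last by nra.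
  by rewrite ler_wpM2r // ler_wpM2l.
have E1 (x y z w : R) : x != 0 -> y != 0 -> z != 0 ->
    3 * x ^+ 2 * (w / y) / (z * x) = 3 * x * w / (y * z).
  by move=> hx hy hz; field; rewrite ?hx ?hy ?hz.
(* Origin of 243: the squared binomial contributes [3 ^+ 2] and the cubed edge factor [3 ^+ 3]. *)
have E2 (x y z w : R) : x != 0 -> y != 0 -> z != 0 ->
    (3 * y / x) ^+ 2 * (3 * x * w / (y * z)) ^+ 3 = 243 * (w / z) ^+ 3 * (x / y).
  by move=> hx hy hz; field; rewrite ?hx ?hy ?hz.
have base : 3 * s%:R ^+ 2 * p / (2 * r%:R) <= be.
  apply: le_trans (_ : 3 * s%:R ^+ 2 * (d / n%:R) / (m%:R * s%:R) <= _).
    apply: ler_pM; rewrite ?mulr_ge0 ?exprn_ge0 ?invr_ge0 ?mulr_ge0 //.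
      by rewrite ler_wpM2l ?mulr_ge0 ?exprn_ge0.
    by rewrite lef_pV2 ?posrE ?mulr_gt0 // -!natrM ler_nat.
  by rewrite E1 ?gt_eqF.
have rhs0 : 0 <= 4 * Num.sqrt (A / n%:R) * 2^-1 ^+ s.
  by rewrite !mulr_ge0 ?sqrtr_ge0 ?exprn_ge0.
have base0 : 0 <= 3 * s%:R ^+ 2 * p / (2 * r%:R).
  by rewrite divr_ge0 ?mulr_ge0 ?exprn_ge0.
rewrite -(@ler_pXn2r _ 2) ?nnegrE ?mulr_ge0 // ?(exprn_ge0 _ base0) //.
have C1 : 'C(n, s)%:R <= (3 * n%:R / s%:R) ^+ s :> R.
  by have := @bin_exp_le R n s 1 ler01 s0; rewrite expr1n !mulr1.
have B1 : (3 * s%:R ^+ 2 * p / (2 * r%:R)) ^+ r ^+ 2 <= be ^+ 3 ^+ s.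
  rewrite -!exprM; apply: le_trans (_ : be ^+ (r * 2) <= _).
    by rewrite lerXn2r ?nnegrE ?divr_ge0 ?mulr_ge0 ?exprn_ge0.
  by rewrite ler_wiXn2l // [(r * 2)%N]mulnC (leq_trans _ mr) // leq_mul2r m2 orbT.
rewrite exprMn; apply: le_trans (_ : (A * (s%:R / n%:R)) ^+ s <= _).
  apply: le_trans (_ : ((3 * n%:R / s%:R) ^+ s) ^+ 2 * be ^+ 3 ^+ s <= _).
    apply: ler_pM; rewrite ?exprn_ge0 // ?divr_ge0 ?mulr_ge0 ?exprn_ge0 //.
    by rewrite lerXn2r ?nnegrE ?exprn_ge0 ?divr_ge0 ?mulr_ge0.
  by rewrite -exprM mulnC exprM -exprMn /be E2 ?gt_eqF.
have x16 : A * (s%:R / n%:R) <= 16^-1.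
  apply: le_trans Aeps; rewrite ler_wpM2l // ler_pdivrMr //.
(* One factor [A * s / n] is kept for the decay in [n]. The others are at most
   [1 / 16 = 1 / 4 * 1 / 4]: one quarter becomes [2^-1] under the square root, the other absorbs the
   factor [s]. *)
case: s s0 s0' x16 {sn be be0 be1 base base0 rhs0 C1 B1 mr r0 r0' r} => // s _ s0' x16.
have x0 : 0 <= A * (s.+1%:R / n%:R) by rewrite mulr_ge0 ?divr_ge0.
rewrite [leRHS]exprMn [in X in _ <= X * _]exprMn sqr_sqrtr ?divr_ge0 // [leLHS]exprS.
apply: le_trans (_ : A * (s.+1%:R / n%:R) * 16^-1 ^+ s <= _).
  by rewrite ler_wpM2l // lerXn2r ?nnegrE.
have -> : (2^-1 ^+ s.+1) ^+ 2 = 4^-1 * (4^-1 ^+ s) :> R.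
  by rewrite -exprM mulnC exprM -exprS; congr (_ ^+ _); field.
have -> : 16^-1 ^+ s = 4^-1 ^+ s * 4^-1 ^+ s :> R.
  by rewrite -exprMn; congr (_ ^+ _); field.
have s4 : s.+1%:R * 4^-1 ^+ s <= 1 :> R.
  rewrite exprVn ler_pdivrMr ?exprn_gt0 // mul1r -natrX ler_nat.
  by rewrite ltn_expl.
have An : 0 <= A / n%:R by rewrite divr_ge0.
have q0 : 0 <= 4^-1 ^+ s :> R by rewrite exprn_ge0 // invr_ge0.
have -> : A * (s.+1%:R / n%:R) * (4^-1 ^+ s * 4^-1 ^+ s) =
  (A / n%:R * 4^-1 ^+ s) * (s.+1%:R * 4^-1 ^+ s) by ring.
have E3 (u v : R) : 4 ^+ 2 * u * (4^-1 * v) = (u * v) * 4 by field.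
rewrite E3 ler_wpM2l ?mulr_ge0 ?ler0n //.
by apply: le_trans s4 _; rewrite ler1n.
Qed.

(** * The exceptional events and their probabilities *)

Definition locally_sparse (R : realType) n (f : {ffun 'I_n * 'I_n -> bool})
    (eps : R) (m : nat) : bool :=
  [forall S : {set 'I_n}, (0 < #|S|)%N && (#|S|%:R <= eps * n%:R) ==>
     (2 * #|back_edges f S| < m * #|S|)%N].

Definition globally_sparse (R : realType) n (f : {ffun 'I_n * 'I_n -> bool})
    (eps d : R) : bool :=
  [forall S : {set 'I_n}, (eps * n%:R <= #|S|%:R) ==>
     (#|back_edges f S|%:R <= 3 * #|S|%:R ^+ 2 * d / n%:R)].

Definition triangle_vertices n (f : {ffun 'I_n * 'I_n -> bool}) : {set 'I_n} :=
  [set v | [exists xy : 'I_n * 'I_n, [&& back f v xy.1, back f xy.1 xy.2 & back f v xy.2]]].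

Section Events.
Variables (R : realType) (n : nat) (p d : R).
Hypotheses (p01 : 0 <= p <= 1) (n0 : (0 < n)%N) (d0 : 0 <= d) (pd : p <= d / n%:R).

Let q01 (e : 'I_n * 'I_n) : 0 <= pair_prob p e <= 1.
Proof. exact: pair_prob01. Qed.

Lemma locally_sparse_prob (eps : R) (m : nat) : (2 < m)%N ->
  3 * eps * d <= m%:R -> 243 * (d / m%:R) ^+ 3 * eps <= 16^-1 ->
  bern_prob (@pair_prob R n p) (fun f => ~~ locally_sparse f eps m) <=
  8 * Num.sqrt (243 * (d / m%:R) ^+ 3 / n%:R).
Proof.
move=> m2 epsd Aeps; have [p0 p1] := andP p01.
pose r s := uphalf (m * s).
pose P (S : {set 'I_n}) := (0 < #|S|)%N && (#|S|%:R <= eps * n%:R).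
pose F (s : nat) : R := (3 * s%:R ^+ 2 * p / (2 * (r s)%:R)) ^+ r s.
apply: le_trans (_ : bern_prob (@pair_prob R n p)
    (fun f => [exists S in P, r #|S| <= #|back_edges f S|]%N) <= _).
  apply: bern_prob_le => // f /forallPn[S]; rewrite negb_imply => /andP[PS h].
  by apply/exists_inP; exists S => //; rewrite /r; lia.
apply: le_trans (bern_prob_union q01 _ _) _.
apply: le_trans (_ : \sum_(S | P S) F #|S| <= _).
  apply: ler_sum => S /andP[S0 _]; apply: dense_prob => //.
  by rewrite /r; nia.
(* Grouped by size, the 'C(n, s) sets of size [s] contribute at most the term of [sparse_term]; the
   geometric series then doubles the constant 4. *)
rewrite (partition_big (fun S : {set 'I_n} => inord #|S| : 'I_n.+1) predT) //=.
set B := Num.sqrt _; have B0 : 0 <= B by exact: sqrtr_ge0.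
apply: le_trans (_ : \sum_(s < n.+1) 4 * B * 2^-1 ^+ s <= _); last first.
  by rewrite -mulr_sumr; have := sum_half_pow R n.+1; nra.
apply: ler_sum => s _.
have inordE (S : {set 'I_n}) : (inord #|S| == s) = (#|S| == s).
  by rewrite -val_eqE /= inordK // ltnS -[leqRHS](card_ord n) max_card.
have [Ps | nPs] := boolP ((0 < s)%N && (s%:R <= eps * n%:R)); last first.
  rewrite big_pred0 ?mulr_ge0 ?exprn_ge0 ?invr_ge0 // => S; rewrite inordE /P.
  by apply/negbTE; apply: contra nPs => /andP[/andP[h1 h2] /eqP <-]; rewrite h1.
have /andP[s0 sn] := Ps.
apply: le_trans (sparse_term m2 s0 n0 sn epsd Aeps d0 p0 pd).
rewrite (eq_bigr (fun=> F s)) => [|S]; last by rewrite inordE => /andP[_ /eqP ->].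
rewrite sumr_const -[leLHS]mulr_natl ler_wpM2r //.
  by rewrite exprn_ge0 // divr_ge0 ?mulr_ge0 ?exprn_ge0.
rewrite ler_nat -[n in 'C(n, _)](card_ord n) -card_draws; apply: subset_leq_card.
by apply/fintype.subsetP => S; rewrite unfold_in inordE inE => /andP[].
Qed.

(** The threshold [x S] is at least [2 * n] and makes the base in [dense_prob] at most [1 / 2]. Each
    [S] thus fails with probability at most [4 ^- n], against [2 ^ n] sets. *)
Lemma globally_sparse_prob (eps : R) : 0 <= eps -> 2 <= 3 * eps ^+ 2 * d ->
  bern_prob (@pair_prob R n p) (fun f => ~~ globally_sparse f eps d) <= 2^-1 ^+ n.
Proof.
move=> eps0 epsd; have [p0 p1] := andP p01; have n0' : 0 < n%:R :> R by rewrite ltr0n.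
pose P (S : {set 'I_n}) := eps * n%:R <= #|S|%:R.
pose x (S : {set 'I_n}) : R := 3 * #|S|%:R ^+ 2 * d / n%:R.
pose r S := (Num.truncn (x S)).+1.
apply: le_trans (_ : bern_prob (@pair_prob R n p)
    (fun f => [exists S in P, r S <= #|back_edges f S|]%N) <= _).
  apply: bern_prob_le => // f /forallPn[S]; rewrite negb_imply => /andP[PS].
  rewrite -ltNge => h; apply/exists_inP; exists S => //.
  by rewrite /r truncn_lt_nat // /x divr_ge0 ?mulr_ge0 ?exprn_ge0.
apply: le_trans (bern_prob_union q01 _ _) _.
apply: le_trans (_ : \sum_(S : {set 'I_n}) (2^-1 ^+ n) ^+ 2 <= _); last first.
  rewrite sumr_const -cardsT -powersetT card_powerset cardsT card_ord -[leLHS]mulr_natl.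
  rewrite natrX expr2 mulrA -exprMn mulfV ?pnatr_eq0 // expr1n mul1r //.
rewrite [leLHS]big_mkcond; apply: ler_sum => S _.
case: ifP => [PS | _]; last by rewrite !exprn_ge0.
have xr : x S < (r S)%:R by exact: truncnS_gt.
have nx : 2 * n%:R <= x S.
  rewrite /x ler_pdivlMr //.
  apply: le_trans (_ : 3 * (eps * n%:R) ^+ 2 * d <= _).
    rewrite (_ : 3 * _ * d = 3 * eps ^+ 2 * d * n%:R * n%:R); last by ring.
    by rewrite !ler_wpM2r.
  by rewrite ler_wpM2r // ler_wpM2l // lerXn2r ?nnegrE ?(mulr_ge0 eps0).
have r0' : 0 < (r S)%:R :> R by rewrite ltr0n.
apply: le_trans (dense_prob _ p01 _) _ => //.
apply: le_trans (_ : 2^-1 ^+ r S <= _).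
  rewrite lerXn2r ?nnegrE ?divr_ge0 ?mulr_ge0 ?exprn_ge0 // ler_pdivrMr ?mulr_gt0 //.
  rewrite [leRHS]mulrA mulVf ?pnatr_eq0 // mul1r; apply: le_trans (ltW xr).
  by rewrite /x -[leRHS]mulrA ler_wpM2l // mulr_ge0 // exprn_ge0.
rewrite -exprM ler_wiXn2l ?invr_ge0 //; first lra.
by rewrite -(ler_nat R) natrM; lra.
Qed.

(** At most [n ^ 3] triples [(v, x, y)] can form a triangle, each with probability at most [p ^+ 3];
    Markov's inequality concludes. *)
Lemma triangle_vertices_prob (b : R) :
  b * bern_prob (@pair_prob R n p) (fun f => b <= #|triangle_vertices f|%:R) <= d ^+ 3.
Proof.
have [p0 p1] := andP p01; have n0' : 0 < n%:R :> R by rewrite ltr0n.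
apply: le_trans (bern_card_markov _ _ q01) _.
apply: le_trans (_ : \sum_(v < n) \sum_(xy : 'I_n * 'I_n) p ^+ 3 <= _); last first.
  rewrite !sumr_const !card_prod !card_ord -mulrnA -[leLHS]mulr_natr.
  have -> : (n * n * n = n ^ 3)%N by rewrite !expnS expn0; lia.
  rewrite natrX -exprMn lerXn2r ?nnegrE ?mulr_ge0 //.
  by rewrite -ler_pdivlMr.
apply: ler_sum => v _.
apply: le_trans (bern_prob_union q01 xpredT
  (fun (xy : 'I_n * 'I_n) f => [&& back f v xy.1, back f xy.1 xy.2 & back f v xy.2])) _.
apply: ler_sum => -[x y] _ /=.
pose pr (a b : 'I_n) : 'I_n * 'I_n := if (a < b)%N then (a, b) else (b, a).
have backP f a c : back f a c -> f (pr a c) /\ ((pr a c).1 < (pr a c).2)%N.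
  by rewrite /back /pr; case: ltngtP => //=; rewrite ?orbF.
have [/and3P[vx xy vy] | h] := boolP [&& v != x, x != y & v != y]; last first.
  rewrite /bern_prob big_pred0 ?exprn_ge0 // => f; apply/negbTE; apply: contra h.
  move=> /and3P[h1 h2 h3]; apply/and3P; split.
  - by apply: contraTneq h1 => ->; rewrite back_irr.
  - by apply: contraTneq h2 => ->; rewrite back_irr.
  - by apply: contraTneq h3 => ->; rewrite back_irr.
(* For distinct [v], [x], [y] the three edges are three different coordinates, which yields the
   cube. *)
pose A := [set pr v x; pr x y; pr v y].
have cA : #|A| = 3%N.
  rewrite /A finset.setUC !cardsU1 cards1 !inE /pr.
  move: vx xy vy; rewrite -!val_eqE.
  case: (ltngtP v x) => //= h1 _; case: (ltngtP x y) => //= h2 _;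
  case: (ltngtP v y) => //= h3 _; rewrite !xpair_eqE -!val_eqE /=; lia.
apply: le_trans (_ : bern_prob (@pair_prob R n p) (fun f => [forall e in A, f e]) <= _).
  apply: bern_prob_le => // f /and3P[/backP[h1 _] /backP[h2 _] /backP[h3 _]].
  by apply/forall_inP => e; rewrite !inE -orbA => /or3P[] /eqP ->.
rewrite bern_prob_all -cA -prodr_const; apply: ler_prod => e _.
by rewrite /pair_prob; case: ifP; rewrite ?lexx ?p0.
Qed.

End Events.

(** * Colouring a configuration outside the exceptional events *)

Lemma locally_sparse_coloring (R : realType) n (f : {ffun 'I_n * 'I_n -> bool})
    (eps : R) m (U : {set 'I_n}) :
  locally_sparse f eps m.+1 -> #|U|%:R <= eps * n%:R ->
  exists g : 'I_n -> 'I_m.+1, {in U &, forall x y, back f x y -> g x != g y}.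
Proof.
move=> /forallP sp Un; apply: degenerate_coloring; [exact: back_sym | exact: back_irr |].
move=> S SU S0; apply/exists_inP; apply: contraT => /exists_inPn h.
(* If all degrees inside [S] exceeded [m], the average degree would contradict local sparsity. *)
have : (m.+1 * #|S| <= \sum_(v in S) #|nbrs (back f) S v|)%N.
  by rewrite mulnC -sum_nat_const; apply: leq_sum => v /h; rewrite -ltnNge.
rewrite sum_nbrs_back leqNgt => /negP[]; apply: (implyP (sp S)); rewrite card_gt0 S0 /=.
by apply: le_trans Un; rewrite ler_nat subset_leq_card.
Qed.

Lemma sparse_chi (R : realType) n (f : {ffun 'I_n * 'I_n -> bool})
    (eps d : R) (L j m k : nat) : (0 < n)%N -> 0 < eps -> 0 < d ->
  8 ^+ L <= 6 * eps * d -> 48 * d < j%:R * L%:R -> (j + m.+1 <= k)%N ->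
  locally_sparse f eps m.+1 -> globally_sparse f (eps / 2) d ->
  #|triangle_vertices f|%:R < eps / 2 * n%:R ->
  (chi (tournament_of f) <= k)%N.
Proof.
move=> n0 eps0 d0 Ld jL jmk ls /forallP gs tri.
have n0' : 0 < n%:R :> R by rewrite ltr0n.
set Bt := triangle_vertices f in tri *.
have [|W [c [WU cj cP Wn]]] := @greedy_classes R _ (back f) (~: Bt) (eps / 2 * n%:R)
    (L%:R * n%:R / (48 * d)) j (back_sym f).
  move=> S SB Sn; pose x := 3 * #|S|%:R ^+ 2 * d / n%:R.
  have eS : #|back_edges f S|%:R <= x by exact: implyP (gs S) Sn.
  have S0 : 0 < #|S|%:R :> R by apply: lt_le_trans Sn; rewrite !mulr_gt0 ?invr_gt0.
  (* Global sparsity makes twice the degree sum of [S] at most [t * #|S|], so [D] is the integer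
     part of [t]. The resulting independent set has size at least
     [L * #|S| / (4 * t) = L * n / (48 * d)], whatever [S] is. *)
  pose t := 12 * #|S|%:R * d / n%:R.
  have t0 : 0 <= t by rewrite !mulr_ge0 ?invr_ge0 // ltW.
  have tD := truncnS_gt t; have Dt : (Num.truncn t)%:R <= t by rewrite truncn_le.
  have [|||I [IS Ii LI]] :=
    @sparse_indep _ (back f) S (Num.truncn t) L (back_sym f) (@back_irr _ f).
  - move=> v x' y vS _ _ vx xy; apply/negP => vy.
    move/fintype.subsetP: SB => /(_ v vS); rewrite !inE => /negP[]; apply/existsP.
    by exists (x', y); rewrite /= vx xy vy.
  - rewrite sum_nbrs_back -(ler_nat R) !natrM.
    have -> : 2 * (2 * #|back_edges f S|%:R) = 4 * #|back_edges f S|%:R :> R by ring.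
    apply: le_trans (_ : 4 * x <= _); first by rewrite ler_wpM2l.
    have -> : 4 * x = t * #|S|%:R by rewrite /x /t; field; rewrite gt_eqF.
    by rewrite ler_wpM2r // ltW.
  - rewrite truncn_ge_nat // natrX; apply: le_trans Ld _.
    rewrite /t ler_pdivlMr //; have := ler_wpM2r (ltW d0) Sn; nra.
  exists I; split => //; rewrite ler_pdivrMr ?mulr_gt0 //.
  have {}LI : L%:R * #|S|%:R <= 4 * t * #|I|%:R.
    have := LI; rewrite -(ler_nat R) !natrM => /le_trans; apply.
    by rewrite ler_wpM2r // ler_wpM2l.
  rewrite -(ler_pM2r S0) mulrAC; apply: le_trans (ler_wpM2r (ltW n0') LI) _.
  have tn : t * n%:R = 12 * #|S|%:R * d by rewrite /t divfK // gt_eqF.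
  have -> : 4 * t * #|I|%:R * n%:R = 4 * #|I|%:R * (t * n%:R) by ring.
  by rewrite tn le_eqVlt; apply/orP; left; apply/eqP; ring.
have {}Wn : #|W|%:R < eps / 2 * n%:R.
  (* Completing all [j] rounds would remove more than [n] vertices. *)
  case: Wn => // h; suff : n%:R < j%:R * (L%:R * n%:R / (48 * d)).
    have : #|~: Bt|%:R <= n%:R :> R by rewrite ler_nat -[leqRHS](card_ord n) max_card.
    have : 0 <= #|W|%:R :> R by []. lra.
  by rewrite mulrA ltr_pdivlMr ?mulr_gt0 // mulrA [n%:R * _]mulrC ltr_pM2r.
have [|g gP] := @locally_sparse_coloring R n f eps m (W :|: Bt) ls.
  apply: le_trans (_ : #|W|%:R + #|Bt|%:R <= _); last lra.
  by rewrite -natrD ler_nat cardsU leq_subr.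
have WBE : ~: Bt :\: W = ~: (W :|: Bt) by rewrite finset.setCU finset.setDE finset.setIC.
rewrite WBE in cj cP; have [|h hP] := glue_coloring cj cP _ jmk (g := g).
  by rewrite finset.setCK.
exact: back_coloring hP.
Qed.

(** * Transitive sets *)

(** For [a < b < c] the two alternatives are the directed cycles [a -> b -> c -> a] and its reverse,
    of probabilities [p * (1 - p) ^+ 2] and [p ^+ 2 * (1 - p)]. *)
Definition cyclic_triple (n : nat) (a b c : 'I_n) (f : {ffun 'I_n * 'I_n -> bool}) : bool :=
  [&& ~~ f (a, b), ~~ f (b, c) & f (a, c)] || [&& f (a, b), f (b, c) & ~~ f (a, c)].

Lemma cyclic_triple_prob (R : realFieldType) (n : nat) (p : R) (a b c : 'I_n) :
  (a < b)%N -> (b < c)%N ->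
  bern_prob (@pair_prob R n p) (cyclic_triple a b c) = p * (1 - p).
Proof.
move=> ab bc; have ac := ltn_trans ab bc.
have nab_bc : (a, b) != (b, c) by rewrite xpair_eqE -!val_eqE (ltn_eqF ab).
have nab_ac : (a, b) != (a, c) by rewrite xpair_eqE -!val_eqE (ltn_eqF bc) andbF.
have nbc_ac : (b, c) != (a, c) by rewrite xpair_eqE -!val_eqE (gtn_eqF ab).
pose A := (a, b) |: ((b, c) |: [set (a, c)]).
have patE (h : 'I_n * 'I_n -> bool) f :
    [forall e in A, f e == h e] =
    [&& f (a, b) == h (a, b), f (b, c) == h (b, c) & f (a, c) == h (a, c)].
  apply/forall_inP/and3P => [H | [h1 h2 h3] e]; first by split; apply: H; rewrite !inE eqxx ?orbT.
  by rewrite !inE => /or3P[] /eqP ->.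
have pat (h : 'I_n * 'I_n -> bool) : bern_prob (@pair_prob R n p)
    (fun f => [forall e in A, f e == h e]) =
    (if h (a, b) then p else 1 - p) * ((if h (b, c) then p else 1 - p) *
    (if h (a, c) then p else 1 - p)).
  rewrite bern_prob_pattern !big_setU1 ?inE ?negb_or ?nab_bc //=.
  by rewrite big_set1 /pair_prob /= ab bc ac.
transitivity (bern_prob (@pair_prob R n p) (fun f =>
    [forall e in A, f e == pred1 (a, c) e] || [forall e in A, f e == predC1 (a, c) e])).
  apply: eq_bigl => f; rewrite !patE /= eqxx nab_ac nbc_ac /cyclic_triple.
  by rewrite !(negbTE nab_ac, negbTE nbc_ac); do 3!case: (f _).
rewrite bern_prob_disjoint => [|f]; last first.
  by rewrite !patE /= eqxx /=; case: (f (a, c)); rewrite /= ?andbF.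
rewrite !pat /= eqxx (negbTE nab_ac) (negbTE nbc_ac) /=; ring.
Qed.

(* The triples [(x_i, x_(q+j), x_(2q+i+j))] of elements of [S], in increasing
   order, are pairwise edge-disjoint because any two of the three indices
   determine [i] and [j]. *)
Lemma transitive_prob (R : realType) (n : nat) (p : R) (S : {set 'I_n}) (q : nat) :
  0 <= p <= 1 -> (4 * q <= #|S|)%N ->
  bern_prob (@pair_prob R n p) (fun f => transitive_on (tournament_of f) S) <=
  (1 - p * (1 - p)) ^+ (q * q).
Proof.
move=> p01 qS; have q01 e : 0 <= @pair_prob R n p e <= 1 by exact: pair_prob01.
have [q0 | q0] := posnP q.
  by rewrite q0 expr0 -(bern_prob_total (@pair_prob R n p)) bern_prob_le.
have /card_gt0P[x0 _] : (0 < #|S|)%N by lia.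
pose x i := nth x0 (enum S) i.
have xS i : (i < #|S|)%N -> x i \in S by move=> iS; rewrite -mem_enum mem_nth -?cardE.
have xlt i j : (i < j)%N -> (j < #|S|)%N -> (x i < x j)%N.
  move=> ij jS; have srt : sorted ltn (map val (enum S)).
    apply: (subseq_sorted ltn_trans _ (iota_ltn_sorted 0 n)); rewrite -val_enum_ord.
    by apply: map_subseq; rewrite [enum 'I_n]enumT filter_subseq.
  have sz k : (k < #|S|)%N -> nth 0%N (map val (enum S)) k = x k.
    by move=> kS; rewrite (nth_map x0) -?cardE.
  rewrite -!sz ?(ltn_trans ij) //; apply: (sorted_ltn_nth ltn_trans) => //;
  by rewrite inE size_map -cardE // (ltn_trans ij).
have xinj i j : (i < #|S|)%N -> (j < #|S|)%N -> x i = x j -> i = j.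
  move=> iS jS xij; case: (ltngtP i j) => // /xlt.
    by rewrite xij ltnn => /(_ jS).
  by rewrite xij ltnn => /(_ iS).
pose a (t : 'I_q * 'I_q) := x t.1.
pose b (t : 'I_q * 'I_q) := x (q + t.2)%N.
pose c (t : 'I_q * 'I_q) := x (2 * q + t.1 + t.2)%N.
have ab t : (a t < b t)%N.
  case: t => i j; have hi := ltn_ord i; have hj := ltn_ord j; rewrite /a /b /=.
  by apply: xlt; rewrite ?(leq_trans _ qS) //; lia.
have bc t : (b t < c t)%N.
  case: t => i j; have hi := ltn_ord i; have hj := ltn_ord j; rewrite /b /c /=.
  by apply: xlt; rewrite ?(leq_trans _ qS) //; lia.
pose A t := [set (a t, b t); (b t, c t); (a t, c t)].
apply: le_trans (_ : bern_prob (@pair_prob R n p)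
    (fun f => [forall t, ~~ cyclic_triple (a t) (b t) (c t) f]) <= _).
  apply: bern_prob_le => // f tr; apply/forallP => -[i j].
  set t := (i, j).
  have aS : a t \in S by apply: xS; apply: leq_trans qS => /=; have := ltn_ord i; lia.
  have bS : b t \in S by apply: xS; apply: leq_trans qS => /=; have := ltn_ord j; lia.
  have cS : c t \in S.
    by apply: xS; apply: leq_trans qS => /=; have := ltn_ord i; have := ltn_ord j; lia.
  move/forall_inP: tr => tr.
  (* Transitivity along [a, b, c] and along [c, b, a] excludes one cyclic orientation each. *)
  have := tr _ aS; move=> /forall_inP/(_ _ bS)/forall_inP/(_ _ cS).
  have := tr _ cS; move=> /forall_inP/(_ _ bS)/forall_inP/(_ _ aS).
  have ac := ltn_trans (ab t) (bc t).
  rewrite !arc_tournament_of ab bc ac !(ltnNge (b t) (a t), ltnNge (c t) (b t), ltnNge (c t) (a t)).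
  rewrite (ltnW (ab t)) (ltnW (bc t)) (ltnW ac) /= /cyclic_triple.
  by do 3!case: (f _).
rewrite (@bern_prob_indep _ _ _ _ A) => [|t t' tt'|t f g fg]; last first.
- by rewrite /cyclic_triple !fg // !inE eqxx ?orbT.
- apply/pred0P => e; apply/negbTE; apply: contra tt'; rewrite /= !inE.
  (* The indices of [a], [b], [c] lie in the disjoint blocks below [q], from [q] to [2 * q], and
     from [2 * q] to [4 * q], so only pairs of the same kind can coincide. *)
  case: t t' => [i j] [i' j']; rewrite xpair_eqE -!val_eqE /=.
  have := ltn_ord i; have := ltn_ord j; have := ltn_ord i'; have := ltn_ord j'.
  move=> hj' hi' hj hi.
  have xE u v : (u < #|S|)%N -> (v < #|S|)%N -> (x u == x v) = (u == v).
    by move=> uS vS; apply/eqP/eqP => [/xinj -> // | ->].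
  case/andP; rewrite -orbA => /or3P[] /eqP ->;
  rewrite !xpair_eqE /a /b /c /= !xE ?(leq_trans _ qS) //; lia.
rewrite (eq_bigr (fun=> 1 - p * (1 - p))) => [|t _].
  by rewrite prodr_const card_prod !card_ord.
by rewrite bern_prob_compl cyclic_triple_prob.
Qed.

(** Pigeonhole on the colour classes; for positive [k] the condition on [s] says that [s] is at most
    [n / k] rounded up. Subsets of a transitive set are transitive, so the size can be made
    exact. *)
Lemma chi_transitive_set n (T : tournament n) (k s : nat) :
  (chi T <= k)%N -> (k * s < n + k)%N ->
  exists2 S : {set 'I_n}, #|S| = s & transitive_on T S.
Proof.
case: s => [_ _|s].
  exists finset.set0; first by rewrite cards0.
  by apply/forall_inP => x; rewrite inE.
rewrite /chi; case: ex_minnP => m /existsP[f /forallP fP] _ mk ks.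
have [c sc] : exists c : 'I_m, (s < #|[set v | f v == c]%SET|)%N.
  apply/existsP; apply: contraT => /existsPn h.
  have : (n <= m * s)%N.
    rewrite -{1}(card_ord n) -sum1_card (partition_big f predT) //=.
    rewrite -[X in (_ <= X * _)%N](card_ord m) -sum_nat_const; apply: leq_sum => c _.
    have := h c; rewrite sum1_card -ltnNge; rewrite ltnS; apply: leq_trans.
    by rewrite subset_leq_card //; apply/fintype.subsetP => v; rewrite !inE.
  by move=> nms; nia.
have : (0 < #|[set F : {set 'I_n} | F \subset [set v | f v == c]%SET & #|F| == s.+1]|)%N.
  by rewrite cards_draws bin_gt0.
case/card_gt0P => S; rewrite inE => /andP[Sc /eqP cS]; exists S => //.
apply/forall_inP => x xS; apply/forall_inP => y yS; apply/forall_inP => z zS.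
have := forall_inP (fP c) _ (fintype.subsetP Sc _ xS).
move=> /forall_inP/(_ _ (fintype.subsetP Sc _ yS)).
by move=> /forall_inP/(_ _ (fintype.subsetP Sc _ zS)).
Qed.

Lemma small_chi_prob (R : realType) (n k : nat) (p : R) : (2 < k)%N -> (6 * k <= n)%N ->
  0 <= p <= 1 -> 192 * k%:R * ln k%:R / n%:R <= p * (1 - p) ->
  bern_prob (@pair_prob R n p) (fun f => chi (tournament_of f) <= k)%N <= k%:R / n%:R.
Proof.
move=> k2 kn p01 px; have [p0 p1] := andP p01.
have q01 e : 0 <= @pair_prob R n p e <= 1 by exact: pair_prob01.
have k0 : 0 < k%:R :> R by rewrite ltr0n; lia.
have n0 : 0 < n%:R :> R by rewrite ltr0n; lia.
pose s := ((n + k.-1) %/ k)%N.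
have ks1 : (n <= k * s)%N.
  by have := divn_eq (n + k.-1) k; have := @ltn_pmod (n + k.-1) k; rewrite /s; nia.
have ks2 : (k * s < n + k)%N by have := leq_divM (n + k.-1) k; rewrite mulnC -/s; lia.
have s6 : (5 < s)%N by nia.
have s0 : 0 < s%:R :> R by rewrite ltr0n; lia.
pose q := (s %/ 4)%N.
have q4 : (4 * q <= s)%N by rewrite mulnC leq_divM.
have q8 : (s <= 8 * q)%N by rewrite /q; lia.
clearbody s q.
pose draws := [set S : {set 'I_n} | #|S| == s].
apply: le_trans (_ : bern_prob (@pair_prob R n p)
    (fun f => [exists S in draws, transitive_on (tournament_of f) S]) <= _).
  apply: bern_prob_le => // f chik.
  have [S cS trS] := chi_transitive_set chik ks2.
  by apply/exists_inP; exists S; rewrite // inE cS.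
apply: le_trans (bern_prob_union q01 _ _) _.
apply: le_trans (_ : \sum_(S in draws) (1 - p * (1 - p)) ^+ (q * q) <= _).
  by apply: ler_sum => S; rewrite inE => /eqP cS; apply: transitive_prob; rewrite // cS.
rewrite sumr_const card_draws card_ord -[leLHS]mulr_natl.
set x := p * (1 - p) in px *.
have x1 : 0 <= 1 - x by rewrite /x; nra.
have lnk : 0 <= ln k%:R :> R by rewrite ln_ge0 // ler1n (leq_trans _ k2).
(* Here [192 = 3 * 64]: from [s <= 8 * q] and [n <= k * s] one gets [x * q ^+ 2 >= x * s ^+ 2 / 64
   >= 3 * s * ln k]. *)
have ex : (1 - x) ^+ (q * q) <= (k%:R ^- 3) ^+ s.
  apply: le_trans (_ : expR (- x) ^+ (q * q) <= _).
    by rewrite lerXn2r ?nnegrE ?expR_ge0 // expR_ge1Dx.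
  rewrite -expRM_natl -[k%:R in leRHS](@lnK R) ?posrE // -expRM_natl -expRN -expRM_natl ler_expR.
  rewrite mulrN mulrN lerN2.
  have h1 : 192 * k%:R * ln k%:R <= x * n%:R by rewrite -ler_pdivrMr.
  have h2 : n%:R <= k%:R * s%:R :> R by rewrite -natrM ler_nat.
  have h3 : s%:R <= 8 * q%:R :> R by rewrite -natrM ler_nat.
  have x0 : 0 <= x by rewrite /x; nra.
  have h4 : 192 * k%:R * ln k%:R <= x * (k%:R * s%:R) by apply: le_trans h1 _; rewrite ler_wpM2l.
  have h5 : 192 * ln k%:R <= x * s%:R.
    by rewrite -(ler_pM2l k0) [k%:R * (192 * _)]mulrCA mulrA [k%:R * (x * _)]mulrCA.
  have h6 : 192 * ln k%:R * s%:R <= x * s%:R * s%:R by rewrite ler_wpM2r // ltW.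
  have h7 : s%:R * s%:R <= (8 * q%:R) * (8 * q%:R) :> R by rewrite ler_pM // ltW.
  have h8 : x * (s%:R * s%:R) <= x * ((8 * q%:R) * (8 * q%:R)) by rewrite ler_wpM2l.
  rewrite natrM; lra.
apply: le_trans (_ : (3 * k%:R) ^+ s * (k%:R ^- 3) ^+ s <= _).
  have C1 : 'C(n, s)%:R <= (3 * n%:R / s%:R) ^+ s :> R.
    have s0' : (0 < s)%N by exact: leq_trans s6.
    by have := @bin_exp_le R n s 1 ler01 s0'; rewrite expr1n !mulr1.
  apply: ler_pM; rewrite ?exprn_ge0 //; apply: le_trans C1 _.
  rewrite lerXn2r ?nnegrE ?divr_ge0 ?mulr_ge0 // ?(ltW s0) // ler_pdivrMr //.
  by rewrite -mulrA ler_wpM2l // -natrM ler_nat.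
(* Each factor is [3 / k ^+ 2], at most [1 / 3] because [k >= 3]. *)
rewrite -exprMn; apply: le_trans (_ : 3^-1 ^+ s <= _).
  have k3 : 3 <= k%:R :> R by rewrite ler_nat.
  rewrite lerXn2r ?nnegrE ?mulr_ge0 ?invr_ge0 ?exprn_ge0 //.
  rewrite ler_pdivrMr ?exprn_gt0 //; have k9 : 9 <= k%:R * k%:R :> R by nra.
  by rewrite !exprS expr0 mulr1; nra.
apply: le_trans (_ : s%:R^-1 <= _).
  rewrite exprVn lef_pV2 ?posrE ?exprn_gt0 // -natrX ler_nat ltnW //.
  exact: ltn_expl.
by rewrite -[k%:R / _]invf_div lef_pV2 ?posrE ?divr_gt0 // ler_pdivrMr // -natrM ler_nat mulnC.
Qed.

(** * Limits and choice of the constants *)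

Local Open Scope classical_set_scope.
Local Open Scope ring_scope.

(** The rate [n ^ (- 1 / 2)] is that of [locally_sparse_prob], the slowest of the failure bounds. *)
Lemma cvg1_sqrt (R : realType) (P : nat -> R) (K : R) : (forall n, P n <= 1) ->
  (\forall n \near \oo, 1 - P n <= K * Num.sqrt n%:R^-1) -> P n @[n --> \oo] --> (1 : R).
Proof.
move=> P1 PK; apply/cvgrPdist_lt => e e0.
near=> n.
have n0 : 0 < n%:R :> R by near: n; exact: nbhs_infty_gtr.
have nK : (`|K| / e) ^+ 2 < n%:R by near: n; exact: nbhs_infty_gtr.
have hP : 1 - P n <= K * Num.sqrt n%:R^-1 by near: n.
rewrite ger0_norm ?subr_ge0 //; apply: le_lt_trans hP _.
apply: le_lt_trans (ler_wpM2r (sqrtr_ge0 _) (ler_norm K)) _.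
rewrite sqrtrV ?ltW // ltr_pdivrMr ?sqrtr_gt0 // mulrC -ltr_pdivrMr //.
have Ke : 0 <= `|K| / e by rewrite divr_ge0 // ltW.
by rewrite -(ger0_norm Ke) -sqrtr_sqr ltr_sqrt.
Unshelve. all: by end_near.
Qed.

Lemma inv_le_sqrt (R : realType) (n : nat) : (n%:R : R)^-1 <= Num.sqrt n%:R^-1.
Proof.
rewrite -[leLHS]ger0_norm ?invr_ge0 // -sqrtr_sqr ler_sqrt ?invr_ge0 //.
case: n => [|n]; first by rewrite invr0 expr0n.
by rewrite expr2 ger_pMl ?invr_gt0 // invf_le1 // ler1n.
Qed.

Lemma chi_le_prob_bound (R : realType) (n k : nat) (p : R) (G : pred {ffun 'I_n * 'I_n -> bool}) :
  0 <= p <= 1 -> (forall f, ~~ G f -> (chi (tournament_of f) <= k)%N) ->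
  1 - tournament_prob p (fun T : tournament n => chi T <= k)%N <=
  bern_prob (@pair_prob R n p) G.
Proof.
move=> p01 GP; have q01 e : 0 <= @pair_prob R n p e <= 1 by exact: pair_prob01.
rewrite tournament_prob_bern -bern_prob_compl; apply: bern_prob_le => // f.
by apply: contraNT => /GP.
Qed.

Lemma tournament_prob_le1 (R : realType) (n : nat) (p : R) (E : pred (tournament n)) :
  0 <= p <= 1 -> tournament_prob p E <= 1.
Proof.
move=> p01; rewrite tournament_prob_bern; apply: bern_prob_le1 => e.
exact: pair_prob01.
Qed.

Lemma chi_le3_whp (R : realType) (p : nat -> R) (k : nat) : (2 < k)%N ->
  (forall n, 0 <= p n <= 1) -> (\forall n \near \oo, p n <= 6^-1 / n%:R) ->
  tournament_prob (p n) (fun T : tournament n => (chi T <= k)%N) @[n --> \oo] --> (1 : R).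
Proof.
move=> k2 p01 pd.
apply: (cvg1_sqrt (K := 8 * Num.sqrt (243 * (6^-1 / 3%:R) ^+ 3))) => [n|].
  exact: tournament_prob_le1.
near=> n.
have n0 : (0 < n)%N by rewrite -(ltr_nat R); near: n; exact: nbhs_infty_gtr.
have pn : p n <= 6^-1 / n%:R by near: n.
(* With [eps = 1] local sparsity covers every vertex set, so the whole graph is 2-degenerate; the
   requirement reads [243 * (1 / 18) ^+ 3 = 1 / 24 <= 1 / 16]. *)
apply: le_trans (chi_le_prob_bound (p01 n) (G := fun f => ~~ locally_sparse f (1 : R) 3) _) _.
  move=> f; rewrite negbK => ls.
  have [|g gP] := @locally_sparse_coloring R n f 1 2 [set: 'I_n]%SET ls.
    by rewrite cardsT card_ord mul1r.
  apply: leq_trans k2; apply: (@back_coloring _ _ _ [ffun x => g x]) => x y exy.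
  by rewrite !ffunE gP ?finset.in_setT.
rewrite -mulrA -sqrtrM ?mulr_ge0 ?exprn_ge0 ?ler0n //.
by apply: locally_sparse_prob; rewrite // ?invr_ge0 //; lra.
Unshelve. all: by end_near.
Qed.

Lemma chi_le_whp (R : realType) (p : nat -> R) (eps d : R) (L j m k : nat) :
  0 < eps -> 0 < d -> (1 < m)%N ->
  8 ^+ L <= 6 * eps * d -> 48 * d < j%:R * L%:R -> (j + m.+1 <= k)%N ->
  3 * eps * d <= m.+1%:R -> 243 * (d / m.+1%:R) ^+ 3 * eps <= 16^-1 ->
  2 <= 3 * (eps / 2) ^+ 2 * d ->
  (forall n, 0 <= p n <= 1) -> (\forall n \near \oo, p n <= d / n%:R) ->
  tournament_prob (p n) (fun T : tournament n => (chi T <= k)%N) @[n --> \oo] --> (1 : R).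
Proof.
move=> eps0 d0 m1 H1 H2 H3 H4 H5 H6 p01 pd; have d0' := ltW d0.
pose A := 243 * (d / m.+1%:R) ^+ 3.
have A0 : 0 <= A by rewrite mulr_ge0 ?exprn_ge0 ?divr_ge0 ?ler0n.
apply: (cvg1_sqrt (K := 8 * Num.sqrt A + 1 + d ^+ 3 / (eps / 2))) => [n|].
  exact: tournament_prob_le1.
near=> n.
have n0 : (0 < n)%N by rewrite -(ltr_nat R); near: n; exact: nbhs_infty_gtr.
have n0' : 0 < n%:R :> R by rewrite ltr0n.
have pn : p n <= d / n%:R by near: n.
have q01 e : 0 <= @pair_prob R n (p n) e <= 1 by exact: pair_prob01.
pose G1 f := ~~ locally_sparse (n := n) f eps m.+1.
pose G2 f := ~~ globally_sparse (n := n) f (eps / 2) d.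
pose G3 f := eps / 2 * n%:R <= #|triangle_vertices (n := n) f|%:R.
apply: le_trans (chi_le_prob_bound (p01 n) (G := fun f => [|| G1 f, G2 f | G3 f]) _) _.
  move=> f; rewrite !negb_or !negbK -ltNge => /and3P[ls gs tri].
  exact: (sparse_chi n0 eps0 d0 H1 H2 H3 ls gs tri).
have unionP (E F : pred {ffun 'I_n * 'I_n -> bool}) :
    bern_prob (@pair_prob R n (p n)) (fun f => E f || F f) <=
    bern_prob (@pair_prob R n (p n)) E + bern_prob (@pair_prob R n (p n)) F.
  apply: le_trans (_ : bern_prob (@pair_prob R n (p n)) (fun f => E f || (F f && ~~ E f)) <= _).
    by apply: bern_prob_le => // f; case: (E f); rewrite //= andbT.
  rewrite bern_prob_disjoint => [|f ->]; last by rewrite andbF.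
  by rewrite lerD2l; apply: bern_prob_le => // f /andP[].
apply: le_trans (unionP _ _) _; rewrite -addrA mulrDl; apply: lerD.
  rewrite -mulrA -sqrtrM //; exact: locally_sparse_prob.
apply: le_trans (unionP _ _) _; rewrite mulrDl; apply: lerD.
  rewrite mul1r; apply: le_trans (globally_sparse_prob (p01 n) n0 d0' pn _ H6) _.
    by rewrite divr_ge0 // ltW.
  apply: le_trans (inv_le_sqrt R n); rewrite exprVn lef_pV2 ?posrE ?exprn_gt0 //.
  by rewrite -natrX ler_nat ltnW // ltn_expl.
apply: le_trans (_ : d ^+ 3 / (eps / 2) * n%:R^-1 <= _); last first.
  by rewrite ler_wpM2l ?inv_le_sqrt // divr_ge0 ?exprn_ge0 // divr_ge0 // ltW.
have e2n : 0 < eps / 2 * n%:R by rewrite !mulr_gt0 // invr_gt0.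
rewrite -mulrA -invfM ler_pdivlMr // mulrC.
exact: (triangle_vertices_prob (p01 n) n0 d0' pn).
Unshelve. all: by end_near.
Qed.

(** Both [p] and [1 - p] are bounded below because [p = 1] gives the reversed linear order, which is
    transitive. The larger of the two is at least [1 / 2], whence [384 = 2 * 192]. *)
Lemma chi_gt_whp (R : realType) (p : nat -> R) (k : nat) : (2 < k)%N ->
  (forall n, 0 <= p n <= 1) ->
  (\forall n \near \oo, 384 * k%:R * ln k%:R / n%:R <= p n <= 1 - 384 * k%:R * ln k%:R / n%:R) ->
  tournament_prob (p n) (fun T : tournament n => (k < chi T)%N) @[n --> \oo] --> (1 : R).
Proof.
move=> k2 p01 pC; apply: (cvg1_sqrt (K := k%:R)) => [n|]; first exact: tournament_prob_le1.
near=> n.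
have kn : (6 * k <= n)%N by rewrite -(ler_nat R); near: n; exact: nbhs_infty_ger.
have : 384 * k%:R * ln k%:R / n%:R <= p n <= 1 - 384 * k%:R * ln k%:R / n%:R by near: n.
have -> : 384 * k%:R * ln k%:R / n%:R = 2 * (192 * k%:R * ln k%:R / n%:R) :> R by ring.
set y := 192 * k%:R * ln k%:R / n%:R => hy; have /andP[p0 p1] := p01 n.
have y0 : 0 <= y by rewrite divr_ge0 ?mulr_ge0 ?ler0n ?ln_ge0 // ler1n (leq_trans _ k2).
rewrite tournament_prob_bern -bern_prob_compl.
apply: le_trans (_ : k%:R / n%:R <= _); last by rewrite ler_wpM2l // inv_le_sqrt.
rewrite (_ : bern_prob _ _ =
  bern_prob (@pair_prob R n (p n)) (fun f => chi (tournament_of f) <= k)%N).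
  apply: small_chi_prob => //; rewrite -/y.
  by have [h | h] := lerP (p n) (1 / 2); nra.
by apply: eq_bigl => f; rewrite -leqNgt.
Unshelve. all: by end_near.
Qed.

(* With [L] of the order of [log k], the three first-moment conditions hold for
   [d = k L / 200] and [eps = 8 ^- L] as soon as [k >= 2 ^ (16 L)]; half of the
   colours go to the independent sets, half to the degenerate remainder. *)
Definition low_const (R : realType) (k : nat) : R :=
  if (trunc_log 2 k %/ 16)%N is L.+1 then k%:R * L.+1%:R / 200 else 6^-1.

Lemma nat_halves (k : nat) : (16 <= k)%N ->
  exists j m, [/\ (1 < m)%N, (j + m.+1 <= k)%N, (k <= 2 * m.+1)%N & (k <= 2 * j + 1)%N].
Proof. by exists (k %/ 2)%N, (k - k %/ 2).-1; split; lia. Qed.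

Lemma chi_le_low_const_whp (R : realType) (p : nat -> R) (k : nat) : (2 < k)%N ->
  (forall n, 0 <= p n <= 1) -> (\forall n \near \oo, p n <= low_const R k / n%:R) ->
  tournament_prob (p n) (fun T : tournament n => (chi T <= k)%N) @[n --> \oo] --> (1 : R).
Proof.
move=> k2 p01; rewrite /low_const.
have := leq_divM (trunc_log 2 k) 16; case: (_ %/ 16)%N => [_|L Lt].
  exact: chi_le3_whp.
pose l := L.+1; rewrite -/l in Lt *.
have l0 : (1 <= l%:R :> R) by rewrite ler1n.
(* Here [b = 8 ^+ l] is the inverse of [eps]. From [k >= b2 ^+ 16] only [1024 * b ^+ 2 <= k] is
   kept, with [b2 >= 2] giving [b2 ^+ 10 >= 1024]. *)
pose b2 : R := 2 ^+ l; pose b := b2 ^+ 3.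
have b22 : 2 <= b2 by rewrite /b2 /l exprS ler_peMr // exprn_ege1 // ler1n.
have b20 : 0 <= b2 by lra.
have kl : b2 ^+ 16 <= k%:R.
  rewrite -exprM -natrX ler_nat; apply: leq_trans (@trunc_logP 2 k isT _); last by lia.
  by rewrite leq_exp2l.
have lb3 : l%:R ^+ 3 <= b.
  rewrite lerXn2r ?nnegrE //; rewrite /b2.
  by rewrite -natrX ler_nat ltnW // ltn_expl.
have b8 : 8 <= b.
  by apply: le_trans (_ : 2 ^+ 3 <= _); [lra | rewrite lerXn2r ?nnegrE //].
have kb : 1024 * b ^+ 2 <= k%:R.
  apply: le_trans kl; rewrite /b -exprM (_ : 16%N = (10 + 6)%N) // exprD.
  rewrite ler_wpM2r ?exprn_ge0 //.
  apply: le_trans (_ : 2 ^+ 10 <= _); first by rewrite le_eqVlt; apply/orP; left; apply/eqP; ring.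
  by rewrite lerXn2r ?nnegrE //.
have b8l : 8 ^+ l = b by rewrite /b /b2 -exprM mulnC exprM; congr (_ ^+ _); ring.
have kR0 : 0 < k%:R :> R by rewrite ltr0n (leq_trans _ k2).
have lR0 : 0 < l%:R :> R by rewrite ltr0n.
have lb : l%:R <= b by apply: le_trans lb3; rewrite -[leLHS]expr1 ler_weXn2l.
clearbody b; clear b2 b22 b20 kl.
have k16 : (16 <= k)%N by rewrite -(ler_nat R); apply: le_trans kb; nra.
have [j [m [m_gt1 jmk mk jk]]] := nat_halves k16.
have {}mk : k%:R <= 2 * m.+1%:R :> R by rewrite -natrM ler_nat.
have {}jk : k%:R <= 2 * j%:R + 1 :> R by rewrite -natrM natr1 ler_nat -addn1.
have kR : 16 <= k%:R :> R by rewrite ler_nat.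
have b0 : 0 < b by lra.
have bb : b^-1 * b = 1 by rewrite mulVf // gt_eqF.
have bi0 : 0 < b^-1 by rewrite invr_gt0.
have m0 : 0 < m.+1%:R :> R by rewrite ltr0n.
have mk' : k%:R / m.+1%:R <= 2 :> R by rewrite ler_pdivrMr.
have kb' : 1024 <= k%:R * b^-1 ^+ 2.
  by rewrite exprVn ler_pdivlMr // exprn_gt0.
apply: (@chi_le_whp R p b^-1 (k%:R * l%:R / 200) l j m k) => //.
- by rewrite divr_gt0 ?ltr0Sn // mulr_gt0.
- rewrite b8l -(ler_pM2r bi0) mulfV ?gt_eqF //.
  rewrite (_ : 6 * b^-1 * _ * b^-1 = (6 / 200) * (k%:R * b^-1 ^+ 2) * l%:R); last by ring.
  by nra.
- by nra.
- rewrite (_ : 3 * b^-1 * _ = (3 / 200) * (l%:R / b) * k%:R); last by ring.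
  have : l%:R / b <= 1 by rewrite ler_pdivrMr // mul1r.
  have : 0 <= l%:R / b by rewrite divr_ge0 // ltW.
  by nra.
- pose w := k%:R / m.+1%:R / 200 : R.
  rewrite (_ : 243 * _ * _ = 243 * w ^+ 3 * (l%:R ^+ 3 / b)); last first.
    by rewrite /w; field; rewrite !gt_eqF.
  have w0 : 0 <= w by rewrite !divr_ge0 ?ler0n.
  (* Since [7 ^ 3 = 343] exceeds 243, cubing this bound controls [243 * w ^+ 3]; the factor [l ^+ 3]
     is absorbed by [eps = b^-1]. *)
  have w1 : 7 * w <= 1 / 4 by rewrite /w; move: (k%:R / m.+1%:R) mk' => z zle; lra.
  have h1 : l%:R ^+ 3 / b <= 1 by rewrite ler_pdivrMr // mul1r.
  have h2 : 0 <= l%:R ^+ 3 / b by rewrite divr_ge0 ?exprn_ge0 // ltW.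
  have h3 : (7 * w) ^+ 3 <= (1 / 4) ^+ 3 by rewrite lerXn2r ?nnegrE ?mulr_ge0 ?ler0n ?divr_ge0.
  have h4 : 0 <= w ^+ 3 by rewrite exprn_ge0.
  rewrite exprMn in h3.
  have h5 : 243 * w ^+ 3 <= 16^-1 by lra.
  apply: le_trans (_ : 243 * w ^+ 3 * 1 <= _); last by rewrite mulr1.
  by rewrite ler_wpM2l // mulr_ge0 ?ler0n.
- rewrite (_ : 3 * _ * _ = (3 / 800) * (k%:R * b^-1 ^+ 2) * l%:R); last by field; rewrite gt_eqF.
  by nra.
Qed.

(** * Order of magnitude of the constants *)

Lemma eqThetaP (R : realType) (f g : nat -> R) (a b : R) : 0 < a -> 0 < b ->
  (\forall k \near \oo, a * `|g k| <= `|f k| <= b * `|g k|) -> f =Theta_\oo g.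
Proof.
move=> a0 b0 H; rewrite eqThetaE qualifE; apply/asboolP; exists (a, b); first by rewrite a0 b0.
by apply: filterS H => k /andP[].
Qed.

Lemma low_const_Theta (R : realType) :
  (low_const R : nat -> R) =Theta_\oo (fun k : nat => k%:R * ln (k%:R : R)).
Proof.
pose Lam : R := ln 2.
have Lam0 : 0 < Lam by rewrite ln_gt0 // ltr1n.
(* If [l >= 1] is the integer part of [trunc_log 2 k / 16], then [l * ln 2 <= ln k <= 16 * (l + 1) *
   ln 2 <= 32 * l * ln 2]; the 200 comes from [low_const]. *)
apply: (@eqThetaP R _ _ (32 * 200 * Lam)^-1 Lam^-1); rewrite ?invr_gt0 ?mulr_gt0 ?ltr0Sn //.
near=> k.
have k0 : (0 < k)%N by near: k; exact: nbhs_infty_gt.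
have t16 : (16 <= trunc_log 2 k)%N.
  by apply: trunc_log_max => //; near: k; exact: nbhs_infty_ge.
have /andP[lo hi] := @trunc_log_bounds 2 k isT k0.
have L0 : (0 < trunc_log 2 k %/ 16)%N by rewrite divn_gt0.
have L1 := leq_divM (trunc_log 2 k) 16; have L2 := ltn_ceil (trunc_log 2 k) (isT : (0 < 16)%N).
rewrite /low_const; case: (_ %/ 16)%N L0 L1 L2 => // L _ L1 L2.
have k0' : 0 < k%:R :> R by rewrite ltr0n.
have lnX (i : nat) : i%:R * Lam = ln (2 ^+ i) by rewrite lnXn ?ltr0n // mulr_natl.
have lnlo : L.+1%:R * Lam <= ln k%:R.
  rewrite lnX ler_ln ?posrE ?exprn_gt0 // -natrX ler_nat.
  by apply: leq_trans lo; rewrite leq_exp2l //; lia.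
have lnhi : ln k%:R <= (L.+2 * 16)%N%:R * Lam.
  rewrite lnX ler_ln ?posrE ?exprn_gt0 // -natrX ler_nat.
  by apply: leq_trans (ltnW hi) _; rewrite leq_exp2l.
have ln0 : 0 <= ln k%:R :> R by rewrite ln_ge0 // ler1n.
have L11 : 1 <= L.+1%:R :> R by rewrite ler1n.
have L2E : L.+2%:R = L.+1%:R + 1 :> R by rewrite -natr1.
rewrite !ger0_norm ?divr_ge0 ?mulr_ge0 ?ler0n //; apply/andP; split.
  rewrite mulrC ler_pdivrMr ?mulr_gt0 ?ltr0Sn //.
  rewrite (_ : k%:R * L.+1%:R / 200 * (32 * 200 * Lam) =
    k%:R * (32 * (L.+1%:R * Lam))); last by field.
  by rewrite ler_pM2l //; apply: le_trans lnhi _; rewrite natrM L2E; nra.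
rewrite [leRHS]mulrC ler_pdivlMr // -!mulrA ler_pM2l //; nra.
Unshelve. all: by end_near.
Qed.

Theorem theorem1p8 (R : realType) :
  exists c C : nat -> R,
    [/\ forall k : nat, (3 <= k)%N ->
          [/\ 0 < c k,
              0 < C k,
              forall p : nat -> R, (forall n, 0 <= p n <= 1) ->
                (\forall n \near \oo, C k / n%:R <= p n <= 1 - C k / n%:R) ->
                tournament_prob (p n) (fun T : tournament n => (k < chi T)%N)
                  @[n --> \oo] --> (1 : R)
            & forall p : nat -> R, (forall n, 0 <= p n <= 1) ->
                (\forall n \near \oo, p n <= c k / n%:R) ->
                tournament_prob (p n) (fun T : tournament n => (chi T <= k)%N)
                  @[n --> \oo] --> (1 : R)],
        c =Theta_\oo (fun k : nat => k%:R * ln (k%:R : R))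
      & C =Theta_\oo (fun k : nat => k%:R * ln (k%:R : R))].
Proof.
exists (low_const R), (fun k => 384 * k%:R * ln k%:R); split.
- move=> k k3; have k0 : 0 < k%:R :> R by rewrite ltr0n; lia.
  split; last 2 first.
  + by move=> p p01 pC; exact: chi_gt_whp.
  + by move=> p p01 pc; exact: chi_le_low_const_whp.
  + rewrite /low_const; case: (_ %/ 16)%N => [|L]; first by rewrite invr_gt0.
    by rewrite divr_gt0 ?ltr0Sn // mulr_gt0.
  + by rewrite !mulr_gt0 ?ltr0Sn // ln_gt0 // ltr1n (leq_trans _ k3).
- exact: low_const_Theta.
- apply: (@eqThetaP R _ _ 384 384); [exact: ltr0Sn | exact: ltr0Sn | near=> k].
  by rewrite -[384 * _ * _]mulrA [`|384 * _|]normrM (ger0_norm (ler0n R 384)) lexx.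
Unshelve. all: by end_near.
Qed.
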